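(* Let $(Q,\tau)$ be a Dynkin $\imath$quiver, let $\mathbb I_\tau$ be a fixed set of representatives of the $\tau$-orbits on $\mathbb I=Q_0$, and let $N_\imath$ be the length of the longest element $w_0$ in $W_\tau$. Then there is an $\imath$-admissible sequence $i_1,\dots,i_{N_\imath}$ in $\mathbb I_\tau$ such that, with $\beta_j:=\mathbf s_{i_1}\cdots\mathbf s_{i_{j-1}}(\alpha_{i_j})$ for $1\le j\le N_\imath$, $$\beta_1,\ \tau(\beta_1),\ \beta_2,\ \tau(\beta_2),\ \dots,\ \beta_{N_\imath},\ \tau(\beta_{N_\imath})$$ is a $Q$-admissible sequence of the roots in $\Phi^+$, where by convention the redundant $\tau(\beta_j)$ is omitted whenever $\tau(\beta_j)=\beta_j$.
   Context: A Dynkin $\imath$quiver $(Q,\tau)$ is a quiver $Q$ whose underlying graph is a Dynkin diagram of type ADE, with a quiver automorphism $\tau$ satisfying $\tau^2=\mathrm{Id}$ ($\tau=\mathrm{Id}$ allowed). $C=(c_{ij})$ is its Cartan matrix, $\Phi$ the root system with simple roots $\alpha_i$ ($i\in\mathbb I$), $\Phi^+$ the positive roots, $s_i(\alpha_j)=\alpha_j-c_{ij}\alpha_i$, $W=\langle s_i\rangle$. $\tau$ acts on roots by $\tau(\sum a_i\alpha_i)=\sum a_i\alpha_{\tau i}$. Restricted Weyl group: $W_\tau=\{w\in W\mid \tau w=w\tau\}$; it is a Coxeter group with simple reflections $\mathbf s_i$ ($i\in\mathbb I_\tau$), where $\mathbf s_i=s_i$ if $\tau i=i$ and $\mathbf s_i=s_is_{\tau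 i}$ if $\tau i\ne i$. $W$ and $W_\tau$ share the same longest element $w_0$; lengths in $W_\tau$ are with respect to the $\mathbf s_i$. For a sink $\ell$ of $Q$, $\mathbf s_\ell(Q)$ is the quiver obtained by reversing all arrows ending at $\ell$ or $\tau\ell$. A sequence $i_1,\dots,i_t$ in $\mathbb I_\tau$ is $\imath$-admissible if $i_r$ is a sink in $\mathbf s_{i_{r-1}}\cdots\mathbf s_{i_1}(Q)$ for each $1\le r\le t$. For $\beta\in\Phi^+$, $M_q(\beta)$ is the indecomposable $kQ$-module with dimension vector $\beta$ ($k=\mathbb F_q$; paths composed right to left, modules are representations). An ordering $\beta_1,\dots,\beta_N$ of all the roots in $\Phi^+$ is $Q$-admissible if $\mathrm{Hom}_{kQ}(M_q(\beta_r),M_q(\beta_t))\ne0$ only if $r\le t$, and $\mathrm{Ext}^1_{kQ}(M_q(\beta_r),M_q(\beta_t))\neq0$ implies $r>t$. This does not depend on $k$. *)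

(* Defs.v *)
From mathcomp Require Import all_boot all_order all_algebra.

Set Implicit Arguments.
Unset Strict Implicit.
Unset Printing Implicit Defensive.

Import Order.TTheory GRing.Theory Num.Theory.
Local Open Scope ring_scope.

Record quiver (I A : finType) := Quiver { src : A -> I; tgt : A -> I }.

Definition sink (I A : finType) (Q : quiver I A) (l : I) : bool :=
  [forall a, src Q a != l].

(** Number of edges between [i] and [j] in the underlying graph
    (number of loops at [i] when [i = j]). *)
Definition nedges (I A : finType) (Q : quiver I A) (i j : I) : nat :=
  #|[set a | ((src Q a == i) && (tgt Q a == j))
             || ((src Q a == j) && (tgt Q a == i))]|.

Definition path_graph (n : nat) : rel 'I_n :=
  fun i j => (i.+1 == j :> nat) || (j.+1 == i :> nat).

(** The path 0 - 1 - ... - (n-2), with vertex n-1 attached to vertex [b]. *)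
Definition fork_graph (b n : nat) : rel 'I_n :=
  let half (i j : 'I_n) :=
    if j.+1 == n then i == b :> nat else i.+1 == j :> nat in
  fun i j => half i j || half j i.

Definition ADE_graph (n : nat) (e : rel 'I_n) : Prop :=
  [\/ (1 <= n)%N /\ e =2 @path_graph n,
      (4 <= n)%N /\ e =2 @fork_graph (n - 3)%N n
    | n \in [:: 6%N; 7%N; 8%N] /\ e =2 @fork_graph 2 n].

Definition dynkin_quiver (I A : finType) (Q : quiver I A) : Prop :=
  exists (n : nat) (e : rel 'I_n) (f : 'I_n -> I),
    [/\ ADE_graph e, bijective f
      & forall i j, nedges Q (f i) (f j) = nat_of_bool (e i j)].

(** The automorphism is given on vertices by [tau] and on arrows by [tauA];
    bijectivity follows from involutivity. *)
Definition dynkin_iquiver (I A : finType) (Q : quiver I A)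
    (tau : I -> I) (tauA : A -> A) : Prop :=
  [/\ dynkin_quiver Q,
      forall a, src Q (tauA a) = tau (src Q a),
      forall a, tgt Q (tauA a) = tau (tgt Q a),
      involutive tau
    & involutive tauA].

Section Roots.
Variables (I A : finType) (Q : quiver I A).

Definition cartan (i j : I) : int :=
  if i == j then 2 else - (nedges Q i j)%:Z.

Definition root_lattice := {ffun I -> int}.

Definition alpha (i : I) : root_lattice := [ffun j => (i == j)%:R].

(** The linear map with s_i(alpha_j) = alpha_j - c_ij alpha_i. *)
Definition refl (i : I) (x : root_lattice) : root_lattice :=
  x - alpha i *~ (\sum_j cartan i j * x j).

(** s_{i_1} ... s_{i_t}; the s_i being involutions, these are exactly the
    elements of W. *)
Definition weyl_word (s : seq I) (x : root_lattice) : root_lattice :=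
  foldr refl x s.

Definition in_weyl (w : root_lattice -> root_lattice) : Prop :=
  exists s, w =1 weyl_word s.

Definition is_root (b : root_lattice) : Prop :=
  exists s i, b = weyl_word s (alpha i).

Definition is_pos_root (b : root_lattice) : Prop :=
  is_root b /\ forall i, 0 <= b i.

Variable tau : I -> I.

Definition tau_act (x : root_lattice) : root_lattice :=
  \sum_i alpha (tau i) *~ x i.

Definition in_Wtau (w : root_lattice -> root_lattice) : Prop :=
  in_weyl w /\ forall x, tau_act (w x) = w (tau_act x).

Definition brefl (i : I) (x : root_lattice) : root_lattice :=
  if tau i == i then refl i x else refl i (refl (tau i) x).

Definition brefl_word (s : seq I) (x : root_lattice) : root_lattice :=
  foldr brefl x s.

Definition orbit_representatives (J : {set I}) : Prop :=
  forall i, #|J :&: [set i; tau i]| = 1%N.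

Variable J : {set I}.

Definition Wtau_length (w : root_lattice -> root_lattice) (n : nat) : Prop :=
  (exists s : seq I,
      [/\ {subset s <= J}, w =1 brefl_word s & size s = n])
  /\ forall s : seq I, {subset s <= J} -> w =1 brefl_word s -> (n <= size s)%N.

Definition Wtau_longest (w0 : root_lattice -> root_lattice) : Prop :=
  in_Wtau w0 /\
  forall w m n, in_Wtau w -> Wtau_length w m -> Wtau_length w0 n -> (m <= n)%N.

(** beta_j = bs_{i_1} ... bs_{i_{j-1}} (alpha_{i_j}), with j counted from 0. *)
Definition beta (n : nat) (s : n.-tuple I) (j : 'I_n) : root_lattice :=
  brefl_word (take j s) (alpha (tnth s j)).

Definition beta_seq (n : nat) (s : n.-tuple I) : seq root_lattice :=
  flatten [seq (if tau_act (beta s j) == beta s j then [:: beta s j]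
                else [:: beta s j; tau_act (beta s j)]) | j <- enum 'I_n].

End Roots.

Definition reflect_quiver (I A : finType) (tau : I -> I) (l : I)
    (Q : quiver I A) : quiver I A :=
  let rev a := (tgt Q a == l) || (tgt Q a == tau l) in
  {| src := fun a => if rev a then tgt Q a else src Q a;
     tgt := fun a => if rev a then src Q a else tgt Q a |}.

Fixpoint iadmissible (I A : finType) (tau : I -> I) (Q : quiver I A)
    (s : seq I) : bool :=
  if s is i :: s' then sink Q i && iadmissible tau (reflect_quiver tau i Q) s'
  else true.

(** Finite-dimensional representations.  As paths are composed from right to
    left, these are the left kQ-modules. *)
Record rep (k : fieldType) (I A : finType) (Q : quiver I A) := Rep {
  space :> I -> vectType k;
  act : forall a : A, 'Hom(space (src Q a), space (tgt Q a)) }.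

Section Reps.
Variables (k : fieldType) (I A : finType) (Q : quiver I A).
Implicit Types M N E : rep k Q.

Definition is_hom M N (f : forall i, 'Hom(M i, N i)) : Prop :=
  forall a, (f (tgt Q a) \o act M a = act N a \o f (src Q a))%VF.

Definition hom_nonzero M N : Prop :=
  exists f : forall i, 'Hom(M i, N i),
    is_hom f /\ exists i, f i <> 0.

Definition short_exact M E N (f : forall i, 'Hom(M i, E i))
    (g : forall i, 'Hom(E i, N i)) : Prop :=
  [/\ is_hom f, is_hom g
    & forall i, [/\ lker (f i) = 0%VS, limg (f i) = lker (g i)
                  & limg (g i) = fullv]].

Definition split_epi E N (g : forall i, 'Hom(E i, N i)) : Prop :=
  exists h : forall i, 'Hom(N i, E i),
    is_hom h /\ forall i, (g i \o h i = \1)%VF.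

(** Ext^1(M, N) is the group of classes of extensions 0 -> N -> E -> M -> 0,
    whose zero is the class of the split ones. *)
Definition ext1_nonzero M N : Prop :=
  exists E (f : forall i, 'Hom(N i, E i)) (g : forall i, 'Hom(E i, M i)),
    short_exact f g /\ ~ split_epi g.

Definition is_subrep M (U : forall i, {vspace M i}) : Prop :=
  forall a, (act M a @: U (src Q a) <= U (tgt Q a))%VS.

Definition indecomposable M : Prop :=
  (exists i, (fullv : {vspace M i}) <> 0%VS) /\
  forall U V : forall i, {vspace M i},
    is_subrep U -> is_subrep V ->
    (forall i, (U i + V i)%VS = fullv /\ (U i :&: V i)%VS = 0%VS) ->
    (forall i, U i = 0%VS) \/ (forall i, V i = 0%VS).

(** [M] is the indecomposable representation of dimension vector [b], which
    for [b] a positive root of a Dynkin quiver exists and is unique up to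
    isomorphism by Gabriel's theorem. *)
Definition is_indec_of (b : root_lattice I) M : Prop :=
  indecomposable M /\ forall i, (\dim (fullv : {vspace M i}))%:Z = b i.

End Reps.

(** Orderings of the positive roots.  The homological condition does not depend
    on the finite field [k], and is required for all of them. *)
Definition Q_admissible (I A : finType) (Q : quiver I A)
    (s : seq (root_lattice I)) : Prop :=
  [/\ uniq s,
      forall b, b \in s <-> is_pos_root Q b
    & forall (k : finFieldType) (r t : nat) (M N : rep k Q),
        (r < size s)%N -> (t < size s)%N ->
        is_indec_of (nth 0 s r) M -> is_indec_of (nth 0 s t) N ->
        (hom_nonzero M N -> (r <= t)%N) /\ (ext1_nonzero M N -> (t < r)%N)].

(* Main.v *)
Require Import Defs.
From HB Require Import structures.
From mathcomp Require Import all_boot all_order all_algebra.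
From mathcomp Require Import zify ring.
From Stdlib Require Import Classical.

Set Implicit Arguments.
Unset Strict Implicit.
Unset Printing Implicit Defensive.

Import Order.TTheory GRing.Theory Num.Theory.
Local Open Scope ring_scope.

(** Everything rests on one property of a Dynkin quiver: its Euler form
    [<x, y> = sum_i x_i y_i - sum_a x_(src a) y_(tgt a)] is positive definite
    ([dynkin_posdef]).

    Roots satisfy [<b, b> = 1], and definiteness then forces their coordinates
    to have a common sign ([root_sign]), lets the reflection at [i] change the
    sign of no positive root other than [alpha i] ([refl_flip]), and separates
    them by their coordinates modulo 3 ([root_mod3_inj]), so that there are
    finitely many of them.

    The sequence is built greedily.  Let [w] be the product of the reflections
    chosen so far and [Q'] the quiver reflected along them.  Reflecting at sinks
    transports the Euler form: [<w x, w y>] for [Q] is [<x, y>] for [Q']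
    ([euler_reflects]).  The roots listed so far are the positive roots made
    negative by the inverse of [w] ([inverted_in_beta_list],
    [beta_list_inverted]).  While a positive root is missing, the set of the
    vertices [i] with [w (alpha i)] positive is nonempty and closed under
    following the arrows of [Q'].  It contains a sink, since a nonempty set of
    vertices each of which has an arrow into the set would have an indicator
    vector of nonpositive Euler form ([next_sink_exists]); reflecting at this
    sink lists one more [tau]-orbit of positive roots.  When the list is
    complete, its number of [tau]-orbits is the length of the longest element:
    a deletion argument ([brefl_word_conj], [reduced_lines]) shows that a reduced
    word produces roots in distinct [tau]-orbits, even up to sign.

    Reading the Euler form on the reflected quivers, where one of the two roots
    has become simple at a sink, gives [<b, c> >= 0 >= <c, b>] whenever [b] is
    listed before [c] ([euler_inverted]).  As the Euler form of dimension vectors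
    is [dim Hom - dim Ext] ([euler_hom_ext]), the homological conditions follow
    once, for indecomposables [M] and [N], the spaces [Hom(M, N)] and
    [Ext(M, N)] are known not to be both nonzero ([hom_ext0]).  This too is
    a consequence of definiteness.  By an argument of Ringel, an indecomposable
    is a brick without self-extensions ([indecomposable_brick_rigid]): otherwise
    one finds a smaller indecomposable with self-extensions, and a brick with
    self-extensions has [dim Hom <= dim Ext].  Now let [f : M -> N] be nonzero
    and [Ext(M, N)] nonzero.  Then [Ext(K, N)] and [Ext(N, K)] are nonzero for
    some indecomposable summand [K] of the kernel of [f], while by induction
    [Hom(K, N)] and [Hom(N, K)] vanish; hence [<K + N, K + N> <= 0]. *)

(** * The Euler form *)

Section EulerForm.
Variables (I A : finType) (Q : quiver I A).
Implicit Types x y z : root_lattice I.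

Definition euler x y : int :=
  \sum_i x i * y i - \sum_a x (src Q a) * y (tgt Q a).

Lemma eulerDl x y z : euler (x + y) z = euler x z + euler y z.
Proof.
rewrite /euler addrACA -opprD -!big_split /=; congr (_ - _);
  by apply: eq_bigr => i _; rewrite ffunE mulrDl.
Qed.

Lemma eulerDr x y z : euler z (x + y) = euler z x + euler z y.
Proof.
rewrite /euler addrACA -opprD -!big_split /=; congr (_ - _);
  by apply: eq_bigr => i _; rewrite ffunE mulrDr.
Qed.

Lemma eulerZl x y (c : int) : euler (x *~ c) y = c * euler x y.
Proof.
rewrite /euler mulrBr !mulr_sumr; congr (_ - _);
  by apply: eq_bigr => i _; rewrite ffunMzE -mulrzl mulrA intz.
Qed.

Lemma eulerZr x y (c : int) : euler x (y *~ c) = c * euler x y.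
Proof.
rewrite /euler mulrBr !mulr_sumr; congr (_ - _);
  by apply: eq_bigr => i _; rewrite ffunMzE -mulrzl mulrCA intz.
Qed.

Lemma eulerNl x y : euler (- x) y = - euler x y.
Proof. by rewrite -mulrN1z eulerZl mulN1r. Qed.

Lemma eulerNr x y : euler x (- y) = - euler x y.
Proof. by rewrite -mulrN1z eulerZr mulN1r. Qed.
End EulerForm.

(** * Homomorphisms and extensions of representations *)

Section Representations.
Variables (k : fieldType) (I A : finType) (Q : quiver I A).
Implicit Types L M N K X : rep k Q.

Definition lfuns M N := forall i, 'Hom(M i, N i).
Definition cochain M N := forall a, 'Hom(M (src Q a), N (tgt Q a)).

Lemma is_homP M N (f : lfuns M N) :
  is_hom f <-> forall a u, f _ (act M a u) = act N a (f _ u).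
Proof.
split=> [hf a u | hf a]; first by have /lfunP/(_ u) := hf a; rewrite !comp_lfunE.
by apply/lfunP=> u; rewrite !comp_lfunE.
Qed.

Lemma is_hom_comp L M N (f : lfuns L M) (g : lfuns M N) :
  is_hom f -> is_hom g -> is_hom (fun i => g i \o f i)%VF.
Proof. by move=> /is_homP hf /is_homP hg; apply/is_homP => a u; rewrite !comp_lfunE hf hg. Qed.

Definition coboundary M N (h : lfuns M N) (c : cochain M N) :=
  forall a u, c a u = h _ (act M a u) - act N a (h _ u).

(** Vanishing of [Ext(M, N)].  An extension of [M] by [N] splits over each vertex,
    so it is given by a cochain, which is arbitrary as a path algebra is
    hereditary; it splits when this cochain is a coboundary. *)
Definition ext0 M N := forall c : cochain M N, exists h, coboundary h c.

Definition epi M N (f : lfuns M N) := forall i, limg (f i) = fullv.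
Definition mono M N (f : lfuns M N) := forall i, lker (f i) = 0%VS.
Definition exact L M N (f : lfuns L M) (g : lfuns M N) :=
  forall i, limg (f i) = lker (g i).

Lemma monoK M N (f : lfuns M N) : mono f -> forall i, cancel (f i) (f i)^-1%VF.
Proof. by move=> hf i; apply: lker0_lfunK; rewrite hf. Qed.

Lemma epiK M N (f : lfuns M N) : epi f -> forall i, cancel (f i)^-1%VF (f i).
Proof. by move=> hf i u; rewrite limg_lfunVK // hf memvf. Qed.

Lemma exact0 L M N (f : lfuns L M) (g : lfuns M N) :
  exact f g -> forall i u, g i (f i u) = 0.
Proof. by move=> h i u; apply/eqP; rewrite -memv_ker -h memv_img ?memvf. Qed.

Lemma exactK L M N (f : lfuns L M) (g : lfuns M N) :
  exact f g -> forall i u, g i u = 0 -> f i ((f i)^-1%VF u) = u.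
Proof. by move=> h i u /eqP; rewrite -memv_ker -h => ?; rewrite limg_lfunVK. Qed.

(** Allows a cochain that vanishes on a subobject to be read on the quotient, by
    composing it with a linear section of [g]. *)
Lemma exact_factor L M N (f : lfuns L M) (g : lfuns M N) :
  exact f g -> epi g -> forall i (V : vectType k) (d : 'Hom(M i, V)),
  (forall u, d (f i u) = 0) -> forall u, d ((g i)^-1%VF (g i u)) = d u.
Proof.
move=> hfg hg i V d d0 u; apply/eqP; rewrite -subr_eq0 -linearB /=.
rewrite -[X in d X](@exactK _ _ _ _ _ hfg i) ?d0 //.
by rewrite linearB /= epiK // subrr.
Qed.

(** [Ext^2] vanishes: a cochain extends along a monomorphism, by extending each of
    its components as a linear map. *)
Lemma ext0_mono L M N (j : lfuns L M) :
  is_hom j -> mono j -> ext0 M N -> ext0 L N.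
Proof.
move=> /is_homP hj mj e0 c.
have [h hE] := e0 (fun a => c a \o (j _)^-1)%VF.
exists (fun i => h i \o j i)%VF => a u.
by rewrite !comp_lfunE hj -hE comp_lfunE monoK.
Qed.

(** The exact sequence [Ext(X, N) -> Ext(M, N) -> Ext(K, N)]: after a linear
    correction a cochain on [M] vanishes on [K], and descends to [X]. *)
Lemma ext0_extension K M X N (j : lfuns K M) (p : lfuns M X) :
  is_hom j -> mono j -> is_hom p -> epi p -> exact j p ->
  ext0 X N -> ext0 K N -> ext0 M N.
Proof.
move=> /is_homP hj mj /is_homP hp ep ex eX eK c.
have [h hE] := eK (fun a => c a \o j _)%VF.
pose h' : lfuns M N := fun i => (h i \o (j i)^-1)%VF.
pose d a : 'Hom(M (src Q a), N (tgt Q a)) := (c a - (h' _ \o act M a) + (act N a \o h' _))%VF.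
have d0 a u : d a (j _ u) = 0.
  rewrite !(add_lfunE, opp_lfunE, comp_lfunE) -hj !monoK //.
  by have := hE a u; rewrite comp_lfunE => ->; rewrite addrAC addrNK subrr.
have [g gE] := eX (fun a => d a \o (p _)^-1)%VF.
exists (fun i => h' i + (g i \o p i))%VF => a u.
have := gE a (p _ u); rewrite comp_lfunE (exact_factor ex) //.
rewrite !(add_lfunE, opp_lfunE, comp_lfunE) !linearD /= hp => dE.
by rewrite addrACA -dE addrC -addrA [X in _ + X]addrC subrK subrK.
Qed.

(** The obstruction to extending [r] from the subobject [K] to [M] is the class of
    the push-out of the extension along [r], which lies in [Ext(X, N)]. *)
Lemma extend_hom K M X N (j : lfuns K M) (p : lfuns M X) (r : lfuns K N) :
  is_hom j -> mono j -> is_hom p -> epi p -> exact j p -> is_hom r ->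
  ext0 X N -> exists2 R : lfuns M N, is_hom R & forall i u, R i (j i u) = r i u.
Proof.
move=> /is_homP hj mj /is_homP hp ep ex /is_homP hr eX.
pose R0 : lfuns M N := fun i => (r i \o (j i)^-1)%VF.
pose d a : 'Hom(M (src Q a), N (tgt Q a)) := ((act N a \o R0 _) - (R0 _ \o act M a))%VF.
have d0 a u : d a (j _ u) = 0.
  by rewrite !(add_lfunE, opp_lfunE, comp_lfunE) -hj !monoK // hr subrr.
have [h hE] := eX (fun a => d a \o (p _)^-1)%VF.
exists (fun i => R0 i + (h i \o p i))%VF; last first.
  by move=> i u; rewrite !(add_lfunE, comp_lfunE) monoK // (exact0 ex) linear0 addr0.
apply/is_homP => a u.
have := hE a (p _ u); rewrite comp_lfunE (exact_factor ex) //.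
rewrite !(add_lfunE, opp_lfunE, comp_lfunE) !linearD /= hp => dE.
by rewrite -[X in _ + X](subrK (act N a (h _ (p _ u)))) -dE addrA [_ + (_ - _)]addrC subrK.
Qed.

(** The cochain measuring how far a linear section of [g] is from a homomorphism
    takes its values in the kernel of [g]; a primitive of it corrects the section. *)
Lemma ext0_split M E N (f : lfuns N E) (g : lfuns E M) :
  short_exact f g -> ext0 M N -> split_epi g.
Proof.
case=> /is_homP hf /is_homP hg ex e0.
have mf : mono f by move=> i; have [] := ex i.
have eg : epi g by move=> i; have [] := ex i.
have fg : exact f g by move=> i; have [] := ex i.
have [h hE] := e0 (fun a => (f _)^-1 \o ((act E a \o (g _)^-1) - ((g _)^-1 \o act M a)))%VF.
have dE a u : f _ (h _ (act M a u) - act N a (h _ u))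
    = act E a ((g _)^-1%VF u) - (g _)^-1%VF (act M a u).
  rewrite -hE comp_lfunE (exactK fg) !(add_lfunE, opp_lfunE, comp_lfunE) //.
  by rewrite linearB /= hg !epiK // subrr.
exists (fun i => (g i)^-1%VF + (f i \o h i))%VF; split; last first.
  move=> i; apply/lfunP=> u.
  by rewrite !(add_lfunE, comp_lfunE, id_lfunE) linearD /= epiK // (exact0 fg) addr0.
apply/is_homP => a u; rewrite !(add_lfunE, comp_lfunE) linearD /= -hf.
move: (dE a u); rewrite linearB /= => eq.
by rewrite -[X in _ + X](subrK (f _ (act N a (h _ u)))) eq addrA [_ + (_ - _)]addrC subrK.
Qed.

Lemma ext1_nonzeroP M N : ext1_nonzero M N -> ~ ext0 M N.
Proof. by case=> E [f [g [ex ns]]] e0; apply: ns; apply: ext0_split ex e0. Qed.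

Section Sub.
Variables (M : rep k Q) (U : forall i, {vspace M i}).

Definition subrep : rep k Q :=
  @Rep k I A Q (fun i => subvs_of (U i))
    (fun a => linfun (vsproj (U (tgt Q a))) \o act M a \o linfun vsval)%VF.

Definition incl : lfuns subrep M := fun i => linfun vsval.

Lemma inclE i u : incl i u = vsval u. Proof. by rewrite lfunE. Qed.

Lemma incl_mono : mono incl.
Proof. by move=> i; apply/eqP/lker0P => u v; rewrite !inclE => /subvs_inj. Qed.

Lemma incl_img i : limg (incl i) = U i.
Proof.
apply/vspaceP => u; apply/memv_imgP/idP => [[v _ ->]|uU].
  by rewrite inclE subvsP.
by exists (vsproj (U i) u); rewrite ?memvf // inclE vsprojK.
Qed.

Lemma incl_hom : is_subrep U -> is_hom incl.
Proof.
move=> sU; apply/is_homP => a u; rewrite inclE /= !comp_lfunE inclE lfunE /=.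
rewrite vsprojK //; apply: (subvP (sU a)); apply: memv_img; exact: subvsP.
Qed.

Variables (L : rep k Q) (f : lfuns L M).
Definition corestr : lfuns L subrep := fun i => (linfun (vsproj (U i)) \o f i)%VF.

Lemma corestrK : (forall i u, f i u \in U i) ->
  forall i u, incl i (corestr i u) = f i u.
Proof. by move=> fU i u; rewrite inclE comp_lfunE lfunE /= vsprojK ?fU. Qed.

Lemma corestr_hom : is_subrep U -> (forall i u, f i u \in U i) -> is_hom f ->
  is_hom corestr.
Proof.
move=> sU fU /is_homP hf; apply/is_homP => a u.
have /is_homP hi := incl_hom sU.
apply: subvs_inj; rewrite -!inclE hi !corestrK //; exact: hf.
Qed.
End Sub.

Lemma ker_subrep M N (f : lfuns M N) : is_hom f -> is_subrep (fun i => lker (f i)).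
Proof.
move=> /is_homP hf a; apply/subvP => _ /memv_imgP [u uU ->].
by move: uU; rewrite !memv_ker hf => /eqP ->; rewrite linear0.
Qed.

Lemma img_subrep M N (f : lfuns M N) : is_hom f -> is_subrep (fun i => limg (f i)).
Proof.
move=> /is_homP hf a; apply/subvP => _ /memv_imgP [_ /memv_imgP[u _ ->] ->].
by rewrite -hf memv_img ?memvf.
Qed.

Definition imgmap M N (f : lfuns M N) : lfuns M (subrep (fun i => limg (f i))) :=
  corestr _ f.

Lemma imgmapK M N (f : lfuns M N) i u : incl _ i (imgmap f i u) = f i u.
Proof. by rewrite corestrK // => j v; rewrite memv_img ?memvf. Qed.

Lemma imgmap_hom M N (f : lfuns M N) : is_hom f -> is_hom (imgmap f).
Proof.
move=> hf; apply: corestr_hom => //; first exact: img_subrep.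
by move=> j v; rewrite memv_img ?memvf.
Qed.

Lemma imgmap_epi M N (f : lfuns M N) : epi (imgmap f).
Proof.
move=> i; apply/vspaceP => x; rewrite memvf; apply/memv_imgP.
have /memv_imgP [u _ uE] := subvsP x.
exists u; rewrite ?memvf //; apply: subvs_inj.
by have := imgmapK f u; rewrite inclE uE.
Qed.

Lemma imgmap_exact M N (f : lfuns M N) :
  exact (incl (fun i => lker (f i))) (imgmap f).
Proof.
move=> i; rewrite incl_img; apply/vspaceP => u; rewrite !memv_ker.
by rewrite -(imgmapK f) inclE raddf_eq0 //; apply: subvs_inj.
Qed.

End Representations.

(** * The Euler form counts homomorphisms and extensions *)

Section TotalSpace.
Variables (k : fieldType) (T : finType) (V : T -> vectType k).

(** The direct sum of the spaces [V t], encoded by coordinates in the chosen bases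
    because the family depends on [t]. *)
Definition total : vectType k := {ffun {t : T & 'I_(\dim {: V t})} -> k^o}.
Definition pack (v : forall t, V t) : total :=
  [ffun p => coord (vbasis {: V (tag p)}) (tagged p) (v (tag p))].
Definition unpack (x : total) t : V t :=
  \sum_(j < \dim {: V t}) x (Tagged (fun t => 'I_(\dim {: V t})) j) *: (vbasis {: V t})`_j.

Lemma packK v t : unpack (pack v) t = v t.
Proof.
rewrite [RHS](coord_vbasis (memvf _)); apply: eq_bigr => j _.
by rewrite ffunE.
Qed.

Lemma unpackK x : pack (unpack x) = x.
Proof.
apply/ffunP => -[t j]; rewrite ffunE /= coord_sum_free //.
exact: basis_free (vbasisP _).
Qed.

Lemma unpack_linear t : linear (unpack^~ t).
Proof.
move=> a x y; rewrite scaler_sumr -big_split /=; apply: eq_bigr => j _.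
by rewrite !ffunE scalerDl scalerA.
Qed.

Lemma unpack0 t : unpack 0 t = 0.
Proof. by rewrite /unpack big1 // => j _; rewrite ffunE scale0r. Qed.

Lemma pack_linear a v w : pack (fun t => a *: v t + w t) = a *: pack v + pack w.
Proof. by apply/ffunP => p; rewrite !ffunE linearP. Qed.

Lemma eq_pack v w : (forall t, v t = w t) -> pack v = pack w.
Proof. by move=> vw; apply/ffunP => p; rewrite !ffunE vw. Qed.

Lemma dim_total : \dim {:total} = (\sum_t \dim {: V t})%N.
Proof.
rewrite dimvf [LHS]muln1 card_tagged sumnE big_map big_enum /=.
by apply: eq_bigr => t _; rewrite card_ord.
Qed.
End TotalSpace.

Section Euler.
Variables (k : fieldType) (I A : finType) (Q : quiver I A).
Implicit Types K L M N : rep k Q.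

Definition dimvec M : root_lattice I := [ffun i => (\dim {: M i})%:Z].

Section Delta.
Variables M N : rep k Q.

(** The complex [C0 -> C1] below computes [Hom(M, N)] and [Ext(M, N)]; its Euler
    characteristic depends only on the dimension vectors. *)
Definition C0 := total (fun i => 'Hom(M i, N i)).
Definition C1 := total (fun a => 'Hom(M (src Q a), N (tgt Q a))).

Definition deltaf (x : C0) : C1 :=
  pack (fun a => (unpack x (tgt Q a) \o act M a)
               - (act N a \o unpack x (src Q a)))%VF.

Lemma deltaf_linear : linear deltaf.
Proof.
move=> a x y; rewrite -pack_linear; apply: eq_pack => b.
apply/lfunP => u.
rewrite !(unpack_linear, add_lfunE, scale_lfunE, opp_lfunE, comp_lfunE).
by rewrite linearP /= scalerBr opprD addrACA.
Qed.
HB.instance Definition _ := GRing.isLinear.Build k C0 C1 _ deltaf deltaf_linear.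

Definition delta : 'Hom(C0, C1) := linfun deltaf.

Definition hom_dim := \dim (lker delta).
Definition ext_dim := (\dim {: C1} - \dim (limg delta))%N.

Lemma dim_Hom (U V : vectType k) :
  \dim {: 'Hom(U, V)} = (\dim {: U} * \dim {: V})%N.
Proof. by rewrite !dimvf. Qed.

Lemma euler_hom_ext : euler Q (dimvec M) (dimvec N) = hom_dim%:Z - ext_dim%:Z.
Proof.
have h := limg_ker_dim delta fullv; rewrite capfv in h.
have h1 : (\dim (limg delta) <= \dim {: C1})%N by apply: dimvS; apply: subvf.
have -> : euler Q (dimvec M) (dimvec N) = (\dim {: C0})%:Z - (\dim {: C1})%:Z.
  rewrite /euler !dim_total !(big_morph Posz PoszD (erefl _)); congr (_ - _).
    by apply: eq_bigr => i _; rewrite !ffunE dim_Hom PoszM.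
  by apply: eq_bigr => i _; rewrite !ffunE dim_Hom PoszM.
by rewrite /hom_dim /ext_dim -h; lia.
Qed.

Lemma deltaE (x : C0) a u :
  unpack (delta x) a u = unpack x _ (act M a u) - act N a (unpack x _ u).
Proof.
by rewrite lfunE /= packK !(add_lfunE, opp_lfunE, comp_lfunE).
Qed.

Lemma ker_deltaP (x : C0) :
  x \in lker delta <-> is_hom (unpack x).
Proof.
rewrite memv_ker; split=> [/eqP dx|/is_homP hx].
  apply/is_homP => a u; apply/eqP; rewrite -subr_eq0 -deltaE dx.
  by rewrite unpack0 zero_lfunE.
apply/eqP; rewrite -[LHS]unpackK -[RHS]unpackK; apply: eq_pack => a.
by apply/lfunP => u; rewrite deltaE hx subrr unpack0 zero_lfunE.
Qed.

Lemma hom_eq0 : hom_dim = 0%N <->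
  forall f : lfuns M N, is_hom f -> forall i, f i = 0.
Proof.
split=> [/eqP|h0].
  rewrite dimv_eq0 => /eqP h0 f hf i.
  have : pack f \in lker delta.
    apply/ker_deltaP/is_homP => a u; rewrite !packK; exact: (is_homP f).1.
  rewrite h0 memv0 => /eqP p0.
  by rewrite -(packK (V := fun i => 'Hom(M i, N i)) f) p0 unpack0.
apply/eqP; rewrite dimv_eq0; apply/eqP/vspaceP => x.
rewrite memv0; apply/idP/eqP => [|->]; last exact: mem0v.
move/ker_deltaP => hx; rewrite -[x]unpackK -[RHS]unpackK.
by apply: eq_pack => i; rewrite unpack0 h0.
Qed.

Lemma cochain_imgP (c : cochain M N) :
  pack (V := fun a => 'Hom(M (src Q a), N (tgt Q a))) c \in limg delta
  <-> exists h, coboundary h c.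
Proof.
split.
  case/memv_imgP => x _ cx; exists (unpack x) => a u.
  by rewrite -deltaE -cx packK.
case=> h hE; apply/memv_imgP; exists (pack h); rewrite ?memvf //.
rewrite lfunE; apply: eq_pack => a; apply/lfunP => u.
by rewrite !packK !(add_lfunE, opp_lfunE, comp_lfunE) hE.
Qed.

Lemma ext_eq0 : ext_dim = 0%N <-> ext0 M N.
Proof.
split=> [/eqP e c|e].
  apply/cochain_imgP; suff -> : limg delta = fullv by rewrite memvf.
  by apply/eqP; rewrite eqEdim subvf /= -subn_eq0.
apply/eqP; rewrite subn_eq0; apply: dimvS; apply/subvP => x _.
rewrite -[x]unpackK; apply/cochain_imgP; exact: e.
Qed.

End Delta.

Section Twist.
Variables (K L : rep k Q) (c : cochain K L).

Definition twist (x : C0 K K) : C1 K L :=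
  pack (fun a => c a \o unpack x (src Q a))%VF.

Lemma twist_linear : linear twist.
Proof.
move=> a x y; rewrite -pack_linear; apply: eq_pack => b; apply/lfunP => u.
by rewrite !(unpack_linear, add_lfunE, scale_lfunE, comp_lfunE) linearP.
Qed.
HB.instance Definition _ :=
  GRing.isLinear.Build k (C0 K K) (C1 K L) _ twist twist_linear.
End Twist.

Definition brick K :=
  forall e : lfuns K K, is_hom e -> (exists i, e i <> 0) -> mono e.

(** Pick a cochain [c] from [K] to [L] that is no coboundary.  A nonzero
    endomorphism [e] of the brick [K] is invertible, so composing [c] with [e]
    gives no coboundary either: this embeds [End(K)] into [Ext(K, L)]. *)
Lemma brick_hom_le_ext K L : brick K -> ~ ext0 K L ->
  (hom_dim K K <= ext_dim K L)%N.
Proof.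
move=> bK /not_all_ex_not [c nc].
pose t := linfun (twist c).
have tinj x : x \in lker (delta K K) -> t x \in limg (delta K L) -> x = 0.
  move=> /ker_deltaP hx; rewrite lfunE /= => /cochain_imgP [h hE].
  apply: NNPP => nx; case: nc.
  have ex : exists i, unpack x i <> 0.
    apply: NNPP => n0; apply: nx; rewrite -[x]unpackK -[RHS]unpackK.
    apply: eq_pack => i; rewrite unpack0; apply: NNPP => ni; apply: n0; by exists i.
  have mx := bK _ hx ex.
  have xK i : cancel (unpack x i)^-1%VF (unpack x i).
    by apply: lker0_lfunVK; rewrite mx.
  exists (fun i => h i \o (unpack x i)^-1)%VF => a u.
  have /is_homP hx' := hx.
  have := hE a ((unpack x _)^-1%VF u); rewrite !comp_lfunE xK => ->.
  have -> : act K a ((unpack x (src Q a))^-1%VF u)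
          = (unpack x (tgt Q a))^-1%VF (act K a u).
    by rewrite -[LHS](monoK mx) hx' xK.
  by [].
have dt : \dim (t @: lker (delta K K)) = hom_dim K K.
  apply: limg_dim_eq; apply/vspaceP => x; rewrite memv_cap memv0.
  apply/andP/eqP => [[xk]|->]; last by rewrite !mem0v.
  by rewrite memv_ker => /eqP t0; apply: tinj => //; rewrite t0 mem0v.
have : (t @: lker (delta K K) :&: limg (delta K L) = 0)%VS.
  apply/vspaceP => y; rewrite memv_cap memv0; apply/andP/eqP => [[]|->]; last by rewrite !mem0v.
  by case/memv_imgP => x xk -> tx; rewrite (tinj x xk tx) linear0.
move/dimv_disjoint_sum => ds.
have := dimvS (subvf (t @: lker (delta K K) + limg (delta K L))).
by rewrite ds dt /ext_dim => le; rewrite leq_subRL ?(leq_trans _ le) ?leq_addl // addnC.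
Qed.
End Euler.

(** * Indecomposable summands *)

Section Indecomposables.
Variables (k : fieldType) (I A : finType) (Q : quiver I A).
Implicit Types K L M N X : rep k Q.

Definition rep_dim M := (\sum_i \dim {: M i})%N.

Lemma rep_dim_subrep M (U : forall i, {vspace M i}) :
  rep_dim (subrep U) = (\sum_i \dim (U i))%N.
Proof. by apply: eq_bigr => i _; rewrite dimvf. Qed.

Lemma rep_dim_mono M N (f : lfuns M N) : mono f -> (rep_dim M <= rep_dim N)%N.
Proof.
move=> mf; apply: leq_sum => i _.
rewrite -(@limg_dim_eq _ _ _ (f i)) ?mf ?capv0 //; exact/dimvS/subvf.
Qed.

Lemma sum_eq0 (d : I -> nat) : (\sum_i d i)%N = 0%N -> forall i, d i = 0%N.
Proof. by move=> /eqP; rewrite sum_nat_eq0 => /forallP h i; apply/eqP/(implyP (h i)). Qed.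

Lemma compl_dim M (U V : forall i, {vspace M i}) :
  (forall i, (U i + V i)%VS = fullv /\ (U i :&: V i)%VS = 0%VS) ->
  rep_dim M = (\sum_i \dim (U i) + \sum_i \dim (V i))%N.
Proof.
move=> h; rewrite -big_split; apply: eq_bigr => i _ /=.
by have [<- c0] := h i; rewrite dimv_disjoint_sum.
Qed.

Lemma compl_proj_hom M (U V : forall i, {vspace M i}) :
  is_subrep U -> is_subrep V ->
  (forall i, (U i + V i)%VS = fullv /\ (U i :&: V i)%VS = 0%VS) ->
  is_hom (fun i => daddv_pi (U i) (V i) : 'Hom(M i, M i)).
Proof.
move=> sU sV h; apply/is_homP => a u.
have [hs cs] := h (src Q a); have [ht ct] := h (tgt Q a).
have cs' : (V (src Q a) :&: U (src Q a) = 0)%VS by rewrite capvC.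
have uE : daddv_pi (U (src Q a)) (V (src Q a)) u
        + daddv_pi (V (src Q a)) (U (src Q a)) u = u.
  by rewrite daddv_pi_add // hs memvf.
rewrite -[in LHS]uE linearD /= linearD /= [X in X + _]daddv_pi_id //; last first.
  by apply: (subvP (sU a)); rewrite memv_img ?memv_pi.
have -> : daddv_pi (U (tgt Q a)) (V (tgt Q a))
   (act M a (daddv_pi (V (src Q a)) (U (src Q a)) u)) = 0; last by rewrite addr0.
set v := act M a _.
have vV : v \in V (tgt Q a) by apply: (subvP (sV a)); rewrite memv_img ?memv_pi.
have := daddv_pi_add (w := v) ct; rewrite ht memvf => /(_ isT).
by rewrite (daddv_pi_id _ vV) 1?capvC // => /eqP; rewrite -subr_eq0 addrK => /eqP.
Qed.

(** Induction over a decomposition into indecomposables: the identity of [K] is a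
    sum of idempotents that factor through indecomposable summands.  The first
    premise lets [Z] ignore the difference between pointwise equal families. *)
Lemma summand_ind K (Z : lfuns K K -> Prop) :
  (forall e e' : lfuns K K, (forall i u, e i u = e' i u) -> Z e -> Z e') ->
  Z (fun=> 0) ->
  (forall e e' : lfuns K K, Z e -> Z e' -> Z (fun i => e i + e' i)) ->
  (forall K' (j : lfuns K' K) (p : lfuns K K'),
     indecomposable K' -> is_hom j -> is_hom p ->
     (forall i u, p i (j i u) = u) -> Z (fun i => j i \o p i)%VF) ->
  Z (fun=> \1%VF).
Proof.
have [n] := ubnP (rep_dim K); elim: n K Z => // n IH K Z sz Zext Z0 ZD Zind.
have h1 : is_hom (fun i => \1%VF : 'Hom(K i, K i)).
  by apply/is_homP => a u; rewrite !id_lfunE.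
have [ind|] := classic (indecomposable K).
  apply: (Zext _ _ _ (Zind K (fun=> \1%VF) (fun=> \1%VF) ind h1 h1 _)).
    by move=> i u; rewrite comp_lfunE !id_lfunE.
  by move=> i u; rewrite !id_lfunE.
move=> /not_and_or [zero|dec].
  apply: (Zext _ _ _ Z0) => i u; rewrite id_lfunE zero_lfunE.
  have e : (fullv : {vspace K i}) = 0%VS.
    by apply: NNPP => ne; apply: zero; exists i.
  by apply/esym/eqP; rewrite -memv0 -e memvf.
have [U [V [sU [sV [c [nU nV]]]]]] : exists U V : forall i, {vspace K i},
   is_subrep U /\ is_subrep V /\
   (forall i, (U i + V i)%VS = fullv /\ (U i :&: V i)%VS = 0%VS) /\
   ~ (forall i, U i = 0%VS) /\ ~ (forall i, V i = 0%VS).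
  apply: NNPP => ne; apply: dec => U V sU sV c; apply: NNPP => /not_or_and [nU nV].
  by apply: ne; exists U, V.
have c' i : (V i + U i)%VS = fullv /\ (V i :&: U i)%VS = 0%VS.
  by rewrite addvC capvC.
have pos (W : forall i, {vspace K i}) : ~ (forall i, W i = 0%VS) ->
    (0 < \sum_i \dim (W i))%N.
  move=> nW; rewrite lt0n; apply/eqP => /sum_eq0 W0; apply: nW => i.
  by apply/eqP; rewrite -dimv_eq0 W0.
pose Zpart (U V : forall i, {vspace K i}) := Z (fun i => daddv_pi (U i) (V i)).
have part (W W' : forall i, {vspace K i}) : is_subrep W -> is_subrep W' ->
    (forall i, (W i + W' i)%VS = fullv /\ (W i :&: W' i)%VS = 0%VS) ->
    ~ (forall i, W' i = 0%VS) -> Zpart W W'.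
  move=> sW sW' cW nW'.
  have hpi := compl_proj_hom sW sW' cW.
  have piW i u : (daddv_pi (W i) (W' i) : 'Hom(K i, K i)) u \in W i by exact: memv_pi.
  have hi := incl_hom sW.
  have [p hp pE] : exists2 p : lfuns K (subrep W), is_hom p &
      forall i u, incl W i (p i u) = daddv_pi (W i) (W' i) u.
    exists (corestr W (fun i => daddv_pi (W i) (W' i))); first exact: corestr_hom.
    by move=> i u; rewrite corestrK.
  have pK i u : p i (incl W i u) = u.
    have [_ c0] := cW i.
    by apply: subvs_inj; rewrite -[LHS]inclE pE daddv_pi_id // inclE ?subvsP.
  have H := IH (subrep W) (fun e => Z (fun i => incl W i \o (e i \o p i))%VF).
  have : Z (fun i => incl W i \o (\1 \o p i))%VF.
    apply: H.
    - rewrite rep_dim_subrep; have := compl_dim cW; have := pos _ nW'.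
      by move: sz; lia.
    - move=> e e' ee; apply: Zext => i u; rewrite !comp_lfunE ee //.
    - by apply: Zext Z0 => i u; rewrite !comp_lfunE !zero_lfunE linear0.
    - move=> e e' Ze Ze'; apply: Zext (ZD _ _ Ze Ze') => i u.
      by rewrite !(add_lfunE, comp_lfunE) linearD.
    - move=> K' j q indK' hj hq qK.
      apply: Zext (Zind K' (fun i => incl W i \o j i)%VF (fun i => q i \o p i)%VF _ _ _ _) => //.
      + by move=> i u; rewrite !comp_lfunE.
      + exact: is_hom_comp.
      + exact: is_hom_comp.
      + by move=> i u; rewrite !comp_lfunE pK qK.
  by apply: Zext => i u; rewrite !comp_lfunE id_lfunE pE.
have ZU := part U V sU sV c nV; have ZV := part V U sV sU c' nU.
apply: Zext (ZD _ _ ZU ZV) => i u; rewrite add_lfunE id_lfunE.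
by have [ci c0] := c i; rewrite daddv_pi_add // ci memvf.
Qed.

(** The image of [j] and the kernel of [r] are complementary, so the
    indecomposability of [M] makes [r] injective. *)
Lemma retract_dim M K (j : lfuns K M) (r : lfuns M K) :
  indecomposable M -> indecomposable K -> is_hom j -> is_hom r ->
  (forall i u, r i (j i u) = u) -> (rep_dim M <= rep_dim K)%N.
Proof.
move=> [_ indM] [[i0 ni0] _] hj hr rj.
have := indM _ _ (img_subrep hj) (ker_subrep hr).
case.
- move=> i; split; apply/vspaceP => u.
    rewrite memvf; apply/memv_addP; exists (j i (r i u)); first by rewrite memv_img ?memvf.
    exists (u - j i (r i u)); last by rewrite addrC subrK.
    by rewrite memv_ker linearB /= rj subrr.
  rewrite memv_cap memv0 memv_ker; apply/andP/eqP => [[/memv_imgP [v _ ->]]|->].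
    by rewrite rj => /eqP ->; rewrite linear0.
  by rewrite mem0v linear0.
- move=> j0; case: ni0; apply/vspaceP => u; rewrite memvf memv0; apply/esym/eqP.
  have : j i0 u \in limg (j i0) by rewrite memv_img ?memvf.
  by rewrite j0 memv0 => /eqP e; rewrite -(rj i0 u) e linear0.
by move=> mr; apply: rep_dim_mono mr.
Qed.

Lemma ext_summand K N : ~ ext0 K N ->
  exists K' (j : lfuns K' K) (p : lfuns K K'),
    [/\ indecomposable K', is_hom j, is_hom p,
        forall i u, p i (j i u) = u & ~ ext0 K' N].
Proof.
move=> nK; apply: NNPP => no; apply: nK => c.
pose Z (e : lfuns K K) := exists h : lfuns K N,
   coboundary h (fun a => c a \o e (src Q a))%VF.
suff [h hE] : Z (fun=> \1%VF).
  by exists h => a u; rewrite -hE comp_lfunE id_lfunE.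
apply: summand_ind.
- move=> e e' ee [h hE]; exists h => a u.
  by rewrite -hE !comp_lfunE ee.
- by exists (fun=> 0) => a u; rewrite comp_lfunE !zero_lfunE !linear0 addr0.
- move=> e e' [h hE] [h' hE']; exists (fun i => h i + h' i) => a u.
  have := hE a u; have := hE' a u; rewrite !comp_lfunE add_lfunE linearD /= => -> ->.
  by rewrite !add_lfunE linearD /= opprD addrACA.
- move=> K' j p ind hj hp pj.
  have : ext0 K' N by apply: NNPP => nK'; apply: no; exists K', j, p.
  move=> /(_ (fun a => c a \o j _)%VF) [h hE].
  exists (fun i => h i \o p i)%VF => a u.
  have /is_homP hp' := hp.
  by have := hE a (p _ u); rewrite !comp_lfunE -hp'.
Qed.

Lemma nonzero_summand I0 K (g : lfuns I0 K) : ~ (forall i, g i = 0) ->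
  exists K' (j : lfuns K' K) (p : lfuns K K'),
    [/\ indecomposable K', is_hom j, is_hom p,
        forall i u, p i (j i u) = u & ~ (forall i, (p i \o g i = 0)%VF)].
Proof.
move=> ng; apply: NNPP => no; apply: ng.
suff : forall i u, (\1%VF : 'Hom(K i, K i)) (g i u) = 0.
  by move=> h i; apply/lfunP => u; rewrite -[g i u]id_lfunE h zero_lfunE.
apply: (@summand_ind K (fun e => forall i u, e i (g i u) = 0)).
- by move=> e e' ee h i u; rewrite -ee.
- by move=> i u; rewrite zero_lfunE.
- by move=> e e' h h' i u; rewrite add_lfunE h h' addr0.
- move=> K' j p ind hj hp pj i u.
  have pg0 : forall i, (p i \o g i = 0)%VF.
    by apply: NNPP => npg; apply: no; exists K', j, p.
  by have /lfunP/(_ u) := pg0 i; rewrite !comp_lfunE zero_lfunE => ->; rewrite linear0.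
Qed.

End Indecomposables.

(** * Between indecomposables, Hom or Ext vanishes *)

Lemma ex_least (P : nat -> Prop) :
  (exists n, P n) -> exists2 n, P n & forall m, P m -> (n <= m)%N.
Proof.
case=> n; have [b] := ubnP n; elim: b n => // b IH n ltn Pn.
have [[m [Pm ltm]]|no] := classic (exists m, P m /\ (m < n)%N).
  by apply: IH Pm; apply: leq_trans ltm _.
exists n => // m Pm; rewrite leqNgt; apply/negP => ltm; apply: no; by exists m.
Qed.

Section DirectedCategory.
Variables (k : fieldType) (I A : finType) (Q : quiver I A).
Implicit Types K L M N X : rep k Q.
Hypothesis posdef : forall x : root_lattice I, x != 0 -> 0 < euler Q x x.

Lemma limg_dim_le (U V : vectType k) (f : 'Hom(U, V)) (W : {vspace U}) :
  (\dim (f @: W) <= \dim W)%N.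
Proof. by rewrite -(limg_ker_dim f W) leq_addl. Qed.

Lemma indecomposable_dimvec M : indecomposable M -> dimvec M != 0.
Proof.
case=> -[i ni] _; apply/eqP => /ffunP/(_ i); rewrite !ffunE => -[d0].
by apply: ni; apply/eqP; rewrite -dimv_eq0 d0.
Qed.

(** By induction on the dimension.  If [M] is not a brick, take a nonzero
    noninvertible endomorphism [f] of least rank.  Then [f] has square zero, as
    otherwise [M] would be the direct sum of its kernel and its image.  Some
    indecomposable summand [K'] of the kernel receives a nonzero map from the
    image [X] of [f], and minimality makes it injective.  As [Ext(K', K')] is
    zero by induction, so is [Ext(X, K')], and the projection of the kernel onto
    [K'] extends to [M]; then [K'] is a summand of [M], which is absurd.  Once
    [M] is a brick, self-extensions would give [<M, M> <= 0]. *)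
Lemma indecomposable_brick_rigid M :
  indecomposable M -> brick M /\ ext0 M M.
Proof.
have [n] := ubnP (rep_dim M); elim: n M => // n IH M sz indM.
suff bM : brick M.
  split=> //; apply: NNPP => /(brick_hom_le_ext bM).
  have := posdef (indecomposable_dimvec indM); rewrite euler_hom_ext; lia.
apply: NNPP => nb.
pose rank (f : lfuns M M) := (\sum_i \dim (limg (f i)))%N.
pose bad r := exists f : lfuns M M,
  [/\ is_hom f, ~ (forall i, f i = 0), ~ mono f & rank f = r].
have [] := @ex_least bad.
  apply: NNPP => no; apply: nb => e he [i ei]; apply: NNPP => nm.
  apply: no; exists (rank e), e; split=> // e0; exact: ei.
move=> r [f [hf nf nmf <-]] minf.
have minf' g : is_hom g -> ~ (forall i, g i = 0) -> ~ mono g -> (rank f <= rank g)%N.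
  by move=> hg ng nmg; apply: minf; exists g.
have f2 i u : f i (f i u) = 0.
  suff : forall i, (f i \o f i = 0)%VF.
    by move=> /(_ i) /lfunP /(_ u); rewrite comp_lfunE zero_lfunE.
  apply: NNPP => nff.
  have le : (rank f <= rank (fun i => f i \o f i)%VF)%N.
    apply: minf' nff _; first exact: is_hom_comp.
    move=> mff; apply: nmf => j; apply/eqP/lker0P => x y fxy.
    have /eqP/lker0P inj := mff j; apply: inj.
    by rewrite !comp_lfunE fxy.
  have eqd j : \dim (limg (f j) :&: lker (f j)) = 0%N.
    have split : rank f = (\sum_i \dim (limg (f i) :&: lker (f i))
                         + \sum_i \dim (limg (f i \o f i)%VF))%N.
      rewrite -big_split; apply: eq_bigr => i1 _ /=.
      by rewrite limg_comp limg_ker_dim.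
    have /sum_eq0 h0 : (\sum_i \dim (limg (f i) :&: lker (f i)) = 0)%N.
      have le2 : (rank f <= \sum_i \dim (limg (f i \o f i)%VF))%N := le.
      apply/eqP; move: le2.
      by rewrite split addnC -[X in (_ <= X)%N]addn0 leq_add2l leqn0.
    exact: h0.
  have [_ dec] := indM.
  have [] := dec _ _ (ker_subrep hf) (img_subrep hf); last 1 first.
  - move=> im0; apply: nf => j; apply/lfunP => v; apply/eqP; rewrite zero_lfunE.
    by rewrite -memv0 -(im0 j) memv_img ?memvf.
  - move=> j; have c0 : (lker (f j) :&: limg (f j) = 0)%VS.
      by apply/eqP; rewrite -dimv_eq0 capvC eqd.
    split=> //; apply/eqP; rewrite eqEdim subvf dimv_disjoint_sum //.
    by rewrite -[leqLHS](limg_ker_dim (f j) fullv) capfv leqnn.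
  - by move=> ker0; apply: nmf.
pose X := subrep (fun i => limg (f i)).
pose K := subrep (fun i => lker (f i)).
have imf i (u : X i) : incl _ i u \in lker (f i).
  rewrite inclE memv_ker; have /memv_imgP [v _ ->] := subvsP u.
  by rewrite f2.
pose g : lfuns X K := corestr _ (incl (fun i => limg (f i))).
have hX := incl_hom (img_subrep hf); have hK := incl_hom (ker_subrep hf).
have hg : is_hom g by apply: corestr_hom => //; exact: ker_subrep.
have gE i u : incl _ i (g i u) = incl _ i u by apply: corestrK.
have fpos : (0 < rank f)%N.
  rewrite lt0n; apply/eqP => /sum_eq0 r0; apply: nf => i; apply/lfunP => u.
  apply/eqP; rewrite zero_lfunE -memv0.
  have /eqP := r0 i; rewrite dimv_eq0 => /eqP <-; by rewrite memv_img ?memvf.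
have [|K' [j [p [indK' hj hp pj npg]]]] := @nonzero_summand _ _ _ _ _ _ g.
  move=> g0; apply: nf => i; apply/lfunP => u.
  by rewrite -imgmapK -gE g0 !zero_lfunE linear0.
have hpg := is_hom_comp hg hp.
pose h : lfuns K' M := fun i => (incl _ i \o j i)%VF.
have hh : is_hom h by apply: is_hom_comp.
have injh i : injective (h i).
  move=> x y; rewrite !comp_lfunE !inclE => /subvs_inj /(congr1 (p i)).
  by rewrite !pj.
(* The endomorphism [M -> X -> K' -> M] bounds the rank of [f] by the rank of
   [X -> K']. *)
pose f' : lfuns M M := fun i => (h i \o ((p i \o g i) \o imgmap f i))%VF.
have hf' : is_hom f'.
  by apply: is_hom_comp hh; apply: is_hom_comp hpg; apply: imgmap_hom.
have le : (rank f <= rank f')%N.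
  apply: minf' hf' _ _.
    move=> f'0; apply: npg => i; apply/lfunP => x.
    have := imgmap_epi f i => e; rewrite zero_lfunE.
    have : x \in limg (imgmap f i) by rewrite e memvf.
    case/memv_imgP => u _ ->; apply: (injh i).
    have /lfunP/(_ u) := f'0 i; rewrite zero_lfunE linear0.
    by rewrite [f' i u]comp_lfunE [X in h i X]comp_lfunE.
  move=> mf'; apply: nmf => i; apply/eqP/lker0P => x y fxy.
  have /eqP/lker0P inj := mf' i; apply: inj.
  by rewrite /f' !comp_lfunE fxy.
(* [X -> K'] has rank at least [rank f], which is the dimension of [X]. *)
have mpg : mono (fun i => p i \o g i)%VF.
  move=> i; apply/eqP; rewrite -dimv_eq0; apply/eqP.
  suff s0 : (\sum_i \dim (lker (p i \o g i)%VF) = 0)%N by exact: (sum_eq0 s0).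
  apply/eqP; rewrite -leqn0 -(leq_add2r (rank f)) add0n.
  apply: leq_trans (leq_add (leqnn _) le) _; rewrite -big_split /=.
  apply: leq_sum => i' _.
  have -> : \dim (limg (f i')) = \dim {: X i'} by rewrite dimvf.
  have := limg_ker_dim (p i' \o g i')%VF fullv; rewrite capfv => <-.
  rewrite leq_add2l /f' limg_comp; apply: leq_trans (limg_dim_le _ _) _.
  rewrite limg_comp; apply: dimvS; apply: limgS; exact: subvf.
have szK : (rep_dim K' < rep_dim M)%N.
  have mj : mono j by move=> i; apply/eqP/lker0P; exact: can_inj (pj i).
  apply: leq_ltn_trans (rep_dim_mono mj) _; rewrite rep_dim_subrep.
  have -> : rep_dim M = (\sum_i \dim (lker (f i)) + rank f)%N.
    rewrite -big_split; apply: eq_bigr => i _ /=.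
    by rewrite -(limg_ker_dim (f i)) capfv.
  by rewrite -addn1 leq_add2l.
have [_ eK'] := IH K' (leq_trans szK sz) indK'.
have eX := ext0_mono hpg mpg eK'.
have [R hR RE] := extend_hom hK (@incl_mono _ _ _ _ _ _) (imgmap_hom hf)
  (@imgmap_epi _ _ _ _ _ _ f) (@imgmap_exact _ _ _ _ _ _ f) hp eX.
have := @retract_dim _ _ _ _ M K' h R indM indK' hh hR.
rewrite leqNgt szK => H; suff: false by []; apply: H => i u.
by rewrite comp_lfunE RE pj.
Qed.

(** If both extension spaces were nonzero, then [<K, L> <= - <K, K>] and
    [<L, K> <= - <L, L>] by [brick_hom_le_ext], hence [<K + L, K + L> <= 0]. *)
Lemma orthogonal_ext K L : indecomposable K -> indecomposable L ->
  hom_dim K L = 0%N -> hom_dim L K = 0%N -> ext0 K L \/ ext0 L K.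
Proof.
move=> indK indL h1 h2; apply: NNPP => /not_or_and [nKL nLK].
have [bK rK] := indecomposable_brick_rigid indK.
have [bL rL] := indecomposable_brick_rigid indL.
have le1 := brick_hom_le_ext bK nKL; have le2 := brick_hom_le_ext bL nLK.
have /ext_eq0 e1 := rK; have /ext_eq0 e2 := rL.
have nz : dimvec K + dimvec L != 0.
  apply: contra (indecomposable_dimvec indK) => /eqP/ffunP d0.
  by apply/eqP/ffunP => i; have := d0 i; rewrite !ffunE; lia.
have := posdef nz.
rewrite eulerDl !eulerDr !euler_hom_ext e1 e2 h1 h2; lia.
Qed.

(** By induction on the total dimension.  Suppose [Ext(M, N)] nonzero, and let [X]
    and [K] be the image and the kernel of [f].  As [X] lies in [N], [Ext(X, N)]
    vanishes together with [Ext(N, N)]; so [Ext(K', N)] is nonzero for some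
    indecomposable summand [K'] of [K].  If [Ext(N, K')] vanished, so would
    [Ext(X, K')], and [K'] would be a summand of [M].  By induction there are no
    nonzero homomorphisms between [K'] and [N], against [orthogonal_ext]. *)
Lemma hom_ext0 M N (f : lfuns M N) :
  indecomposable M -> indecomposable N -> is_hom f -> ~ (forall i, f i = 0) ->
  ext0 M N.
Proof.
have [n] := ubnP (rep_dim M + rep_dim N)%N; elim: n M N f => // n IH M N f sz indM indN hf nf.
apply: NNPP => nMN.
have [_ rN] := indecomposable_brick_rigid indN.
pose X := subrep (fun i => limg (f i)).
pose K := subrep (fun i => lker (f i)).
have hX := incl_hom (img_subrep hf); have hK := incl_hom (ker_subrep hf).
have eXN : ext0 X N := ext0_mono hX (@incl_mono _ _ _ _ _ _) rN.
have ext := ext0_extension hK (@incl_mono _ _ _ _ _ _) (imgmap_hom hf)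
  (@imgmap_epi _ _ _ _ _ _ f) (@imgmap_exact _ _ _ _ _ _ f).
have nK : ~ ext0 K N by move=> eK; apply: nMN; exact: ext.
have [K' [j [p [indK' hj hp pj nK']]]] := ext_summand nK.
have szK : (rep_dim K' < rep_dim M)%N.
  have mj : mono j by move=> i; apply/eqP/lker0P; exact: can_inj (pj i).
  apply: leq_ltn_trans (rep_dim_mono mj) _; rewrite rep_dim_subrep.
  have -> : rep_dim M = (\sum_i \dim (lker (f i)) + \sum_i \dim (limg (f i)))%N.
    rewrite -big_split; apply: eq_bigr => i _ /=.
    by rewrite -(limg_ker_dim (f i)) capfv.
  rewrite -addn1 leq_add2l lt0n; apply/eqP => /sum_eq0 r0.
  apply: nf => i; apply/lfunP => u.
  apply/eqP; rewrite zero_lfunE -memv0.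
  have /eqP := r0 i; rewrite dimv_eq0 => /eqP <-; by rewrite memv_img ?memvf.
have hom1 : hom_dim K' N = 0%N.
  apply/hom_eq0 => e he; apply: NNPP => ne; apply: nK'.
  apply: (IH _ _ e) => //; first by move: szK sz; lia.
have nNK : ~ ext0 N K'.
  move=> e0; have eX := ext0_mono hX (@incl_mono _ _ _ _ _ _) e0.
  have [R hR RE] := extend_hom hK (@incl_mono _ _ _ _ _ _) (imgmap_hom hf)
    (@imgmap_epi _ _ _ _ _ _ f) (@imgmap_exact _ _ _ _ _ _ f) hp eX.
  have := @retract_dim _ _ _ _ M K' (fun i => incl _ i \o j i)%VF R indM indK'
    (is_hom_comp hj hK) hR.
  rewrite leqNgt szK => H; suff: false by []; apply: H => i u.
  by rewrite comp_lfunE RE pj.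
have hom2 : hom_dim N K' = 0%N.
  apply/hom_eq0 => e he; apply: NNPP => ne; apply: nNK.
  apply: (IH _ _ e) => //; first by move: szK sz; lia.
by have [/nK'|/nNK] := orthogonal_ext indK' indN hom1 hom2.
Qed.

End DirectedCategory.

(** * Positive definiteness for the ADE graphs *)

(** The part of the Tits form carried by an arm of length [a] of a star-shaped
    graph, where [u 0] is the value at the centre and the term [u 0 ^+ 2] is left
    out. *)
Definition arm (u : nat -> int) (a : nat) : int :=
  \sum_(i < a) (u i.+1 ^+ 2 - u i * u i.+1).

Lemma armS u a :
  arm u a.+1 = u 1%N ^+ 2 - u 0%N * u 1%N + arm (fun i => u i.+1) a.
Proof. by rewrite /arm big_ord_recl. Qed.

(** Completing the square at the vertex next to the centre, with denominators
    cleared. *)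
Lemma arm_step (u : nat -> int) (a : nat) :
  a.+1%:Z * (2 * a.+2%:Z * arm u a.+1 + a.+1%:Z * u 0%N ^+ 2)
  = a.+2%:Z * (2 * a.+1%:Z * arm (fun i => u i.+1) a + a%:Z * u 1%N ^+ 2)
    + (a.+2%:Z * u 1%N - a.+1%:Z * u 0%N) ^+ 2.
Proof. rewrite armS -!natr1; ring. Qed.

(** The arm contributes at least [- a / (2 (a + 1))] times the square of the value
    at the centre; a star is definite when these fractions add up to less than 1. *)
Lemma arm_ge u a : 0 <= 2 * a.+1%:Z * arm u a + a%:Z * u 0%N ^+ 2.
Proof.
elim: a u => [|a IH] u; first by rewrite /arm big_ord0 mulr0 mul0r.
have a1 : 0 < a.+1%:Z by [].
rewrite -(pmulr_rge0 _ a1) arm_step.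
by rewrite addr_ge0 ?sqr_ge0 // mulr_ge0 // IH.
Qed.

Lemma arm_eq0 u a : u 0%N = 0 -> arm u a <= 0 -> forall i, (i <= a)%N -> u i = 0.
Proof.
elim: a u => [|a IH] u u0 le i; first by rewrite leqn0 => /eqP ->.
have h := arm_step u a; have g := arm_ge (fun i => u i.+1) a.
have s := sqr_ge0 (a.+2%:Z * u 1%N - a.+1%:Z * u 0%N).
have le' : a.+1%:Z * (2 * a.+2%:Z * arm u a.+1 + a.+1%:Z * u 0%N ^+ 2) <= 0.
  rewrite u0 expr0n mulr0 addr0 pmulr_rle0 ?ltr0Sn //.
  by rewrite pmulr_rle0 // pmulr_rgt0.
rewrite h in le'.
have g' : 0 <= a.+2%:Z * (2 * a.+1%:Z * arm (fun i => u i.+1) a + a%:Z * u 1%N ^+ 2).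
  by rewrite mulr_ge0.
have /eqP : (a.+2%:Z * u 1%N - a.+1%:Z * u 0%N) ^+ 2 = 0 by lia.
rewrite sqrf_eq0 u0 mulr0 subr0 mulf_eq0 => /orP [//|/eqP u1].
case: i => [//|i] ltia; apply: (IH (fun i => u i.+1)) => //.
move: g'; rewrite u1 expr0n mulr0 addr0 => _.
have : a.+2%:Z * (2 * a.+1%:Z * arm (fun i => u i.+1) a) <= 0.
  move: le' s; rewrite u1 expr0n mulr0 addr0; lia.
by rewrite pmulr_rle0 // pmulr_rle0 // pmulr_rgt0.
Qed.

Definition path_form (u : nat -> int) (m : nat) : int :=
  \sum_(i < m.+1) u i ^+ 2 - \sum_(i < m) u i * u i.+1.

Lemma path_formE u b r :
  path_form u (b + r) =
  u b ^+ 2 + arm (fun i => u (b - i)%N) b + arm (fun i => u (b + i)%N) r.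
Proof.
elim: r => [|r IH].
  rewrite addn0 [arm _ 0]big_ord0 addr0 /path_form big_ord_recr /=.
  rewrite addrAC addrC; congr (_ + _); rewrite -sumrB /arm.
  rewrite (reindex_inj rev_ord_inj) /=; apply: eq_bigr => i _.
  by rewrite -(subnSK (ltn_ord i)) [u _.+1 * _]mulrC.
rewrite addnS /path_form big_ord_recr [\sum_(i < (b + r).+1) (_ * _)]big_ord_recr /=.
rewrite /arm [in RHS]big_ord_recr /= addrA -IH /path_form !addnS; ring.
Qed.

Lemma path_form_gt0 u m : (exists2 i, (i <= m)%N & u i != 0) -> 0 < path_form u m.
Proof.
case=> i lei ui; have := path_formE u m 0; rewrite addn0 [arm _ 0]big_ord0 addr0.
set v := fun i => u (m - i)%N => ->.
have ge := arm_ge v m; have v0 : v 0%N = u m by rewrite /v subn0.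
rewrite v0 in ge; have sq := sqr_ge0 (u m).
have [um|um] := eqVneq (u m) 0.
  rewrite um expr0n add0r ltNge; apply: contra ui => le.
  have := arm_eq0 _ le; rewrite v0 um => /(_ erefl (m - i)%N (leq_subr _ _)).
  by rewrite /v subKn // => ->.
have {}sq : 0 < u m ^+ 2 by rewrite lt0r sqrf_eq0 um.
nia.
Qed.

(** Arms of lengths [b], [r] and 1 leave
    [1 - b / (2 (b + 1)) - r / (2 (r + 1)) - 1 / 4] times the square of the value
    at the centre, which is positive in the listed cases. *)
Lemma fork_form_gt0 u b r v :
  (r = 1%N \/ (b = 2%N /\ (2 <= r <= 4)%N)) ->
  (exists2 i, (i <= b + r)%N & u i != 0) \/ v != 0 ->
  0 < path_form u (b + r) + v ^+ 2 - u b * v.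
Proof.
move=> hbr nz; rewrite path_formE.
set w := fun i => u (b - i)%N; set w' := fun i => u (b + i)%N.
have ge := arm_ge w b; have w0 : w 0%N = u b by rewrite /w subn0.
have ge' := arm_ge w' r; have w0' : w' 0%N = u b by rewrite /w' addn0.
rewrite w0 in ge; rewrite w0' in ge'.
have sv := sqr_ge0 (2 * v - u b).
have [ub|ub] := eqVneq (u b) 0.
  rewrite ub in ge ge' *; rewrite expr0n add0r mul0r subr0.
  have a1 : 0 <= arm w b by move: ge; rewrite expr0n mulr0 addr0 pmulr_rge0.
  have a2 : 0 <= arm w' r by move: ge'; rewrite expr0n mulr0 addr0 pmulr_rge0.
  have a3 := sqr_ge0 v.
  rewrite ltNge; apply/negP => le.
  have /eqP : v ^+ 2 = 0 by lia.
  rewrite sqrf_eq0 => /eqP v0.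
  case: nz => [[i lei /eqP]|]; last by rewrite v0 eqxx.
  have le1 : arm w b <= 0 by lia.
  have le2 : arm w' r <= 0 by lia.
  apply; have [leib|ltbi] := leqP i b.
    have := arm_eq0 (etrans w0 ub) le1 (leq_subr i b).
    by rewrite /w subKn.
  have ler : (i - b <= r)%N by lia.
  have := arm_eq0 (etrans w0' ub) le2 ler.
  by rewrite /w' subnKC // ltnW.
have sq : 0 < u b ^+ 2 by rewrite lt0r sqrf_eq0 ub sqr_ge0.
have svE : (2 * v - u b) ^+ 2 = 4 * (v ^+ 2 - u b * v) + u b ^+ 2 by ring.
rewrite svE in sv; set z := u b ^+ 2 in ge ge' sq sv *.
set V := v ^+ 2 - u b * v in sv; rewrite -addrA -/V.
move: (arm w b) (arm w' r) ge ge' => L R ge ge'.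
case: hbr => [r1|[b2 r24]].
  rewrite r1 in ge'; have : 0 < 2 * L + z by nia.
  lia.
rewrite b2 in ge; case: r r24 ge' {nz w' w0'} => [|[|[|[|[|r]]]]] //= _ ge'; lia.
Qed.

Section GraphForms.
Variable n : nat.

(** Listing each edge in one direction only, as [h] does, halves the sum over the
    symmetric relation [e]. *)
Lemma oriented_graph_form (e h : rel 'I_n) (y : 'I_n -> int) :
  (forall i j, e i j = h i j || h j i) -> (forall i j, h i j -> ~~ h j i) ->
  \sum_i \sum_j (e i j)%:Z * (y i * y j)
  = 2 * \sum_j \sum_i (h i j)%:Z * (y i * y j).
Proof.
move=> eE hE.
have -> : \sum_i \sum_j (e i j)%:Z * (y i * y j) =
    \sum_i \sum_j (h i j)%:Z * (y i * y j) + \sum_i \sum_j (h j i)%:Z * (y j * y i).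
  rewrite -big_split; apply: eq_bigr => i _ /=; rewrite -big_split.
  apply: eq_bigr => j _ /=; rewrite eE; have := hE i j.
  by case: (h i j) => [/(_ isT) /negbTE ->|_] /=; case: (h j i); ring.
by rewrite exchange_big /= mulr_natl mulr2n.
Qed.
End GraphForms.

Lemma sum_ord_eq (m k : nat) (F : nat -> int) :
  \sum_(i < m) (i == k :> nat)%:Z * F i = if (k < m)%N then F k else 0.
Proof.
case: ltnP => [lt|le].
  rewrite (bigD1 (Ordinal lt)) //= eqxx mul1r big1 ?addr0 // => i ne.
  by rewrite (_ : (i == k :> nat) = false) ?mul0r //; apply/negbTE.
apply: big1 => i _; have := ltn_ord i.
by case: eqP => [->|_]; rewrite ?mul0r // ltnNge le.
Qed.

Lemma path_halfsum m (u : nat -> int) (M : nat) : (m <= M)%N ->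
  \sum_(j < m.+1) \sum_(i < M.+1) (i.+1 == j :> nat)%:Z * (u i * u j)
  = \sum_(i < m) u i * u i.+1.
Proof.
move=> le; rewrite big_ord_recl big1 ?add0r => [|i _]; last by rewrite mul0r.
apply: eq_bigr => j _; under eq_bigr => i _ do rewrite /= eqSS.
rewrite (sum_ord_eq _ _ (fun i => u i * u j.+1)).
by rewrite (leq_trans (ltn_ord j) (leqW le)).
Qed.

Lemma ADE_posdef n (e : rel 'I_n) (y : 'I_n -> int) : ADE_graph e ->
  (exists i, y i != 0) ->
  0 < 2 * (\sum_i y i ^+ 2) - \sum_i \sum_j (e i j)%:Z * (y i * y j).
Proof.
have twice (a b : int) : (0 < 2 * a - 2 * b) = (0 < a - b) by lia.
have fork m b r (e' : rel 'I_m.+2) (z : 'I_m.+2 -> int) :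
    m = (b + r)%N -> (r = 1%N \/ (b = 2%N /\ (2 <= r <= 4)%N)) ->
    e' =2 @fork_graph b m.+2 -> (exists i, z i != 0) ->
    0 < 2 * (\sum_i z i ^+ 2) - \sum_i \sum_j (e' i j)%:Z * (z i * z j).
  move=> mE hbr e'E [i0 zi0].
  pose u k := z (inord k); have zE i : z i = u i by rewrite /u inord_val.
  pose h (i j : 'I_m.+2) :=
    if j.+1 == m.+2 then i == b :> nat else i.+1 == j :> nat.
  rewrite (@oriented_graph_form _ _ h) //; last first.
    move=> i j; rewrite /h; have := ltn_ord i; have := ltn_ord j.
    move: (nat_of_ord i) (nat_of_ord j) => a c.
    by case: (c.+1 =P m.+2); case: (a.+1 =P m.+2); lia.
  rewrite twice.
  have -> : \sum_i z i ^+ 2 = \sum_(i < m.+1) u i ^+ 2 + u m.+1 ^+ 2.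
    by rewrite big_ord_recr /= zE; congr (_ + _); apply: eq_bigr => i _; rewrite zE.
  have -> : \sum_j \sum_i (h i j)%:Z * (z i * z j)
      = \sum_(i < m) u i * u i.+1 + u b * u m.+1.
    rewrite big_ord_recr /=; congr (_ + _).
      rewrite -(@path_halfsum m u m.+1) //; apply: eq_bigr => j _.
      apply: eq_bigr => i _; rewrite !zE /h /=.
      by have := ltn_ord j; case: eqP => //; lia.
    rewrite /h /= eqxx; under eq_bigr => i _ do rewrite !zE.
    rewrite (sum_ord_eq _ _ (fun i => u i * u m.+1)).
    by case: ltnP => //; lia.
  have := @fork_form_gt0 u b r (u m.+1) hbr; rewrite -mE => /(_ _).
  rewrite /path_form => H.
  have {}H : 0 < \sum_(i < m.+1) u i ^+ 2 - \sum_(i < m) u i * u i.+1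
                + u m.+1 ^+ 2 - u b * u m.+1.
    apply: H; move: zi0; rewrite zE; have := ltn_ord i0; rewrite ltnS leq_eqVlt.
    by case/orP => [/eqP ->|lt] nz; [right|left; exists i0].
  by move: H; lia.
case=> [[n1 eE]|[n4 eE]|[nE eE]].
- case: n n1 e y eE => [//|m] _ e y eE [i0 yi0].
  pose u k := y (inord k); have yE i : y i = u i by rewrite /u inord_val.
  rewrite (@oriented_graph_form _ _ (fun i j => i.+1 == j :> nat)) //; last first.
    by move=> i j /eqP <-; lia.
  rewrite twice.
  under eq_bigr => i _ do rewrite yE.
  under [X in _ - X]eq_bigr => j _ do under eq_bigr => i _ do rewrite !yE.
  rewrite path_halfsum //; apply: path_form_gt0; exists i0; last by rewrite -yE.
  by rewrite -ltnS.
- case: n n4 e y eE => [|[|m]] // m2 e y eE; apply: (fork m (m.+2 - 3)%N 1%N) => //.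
    by lia.
  by left.
case: n nE e y eE => [|[|m]] // mE e y eE; apply: (fork m 2%N (m - 2)%N) => //.
  by move: mE; rewrite !inE; lia.
by right; split=> //; move: mE; rewrite !inE; lia.
Qed.

(** * The symmetrized Euler form and the Cartan matrix *)

Section SymmetricForm.
Variables (I A : finType) (Q : quiver I A).
Implicit Types x y z b c : root_lattice I.

Definition cform x y := euler Q x y + euler Q y x.

Lemma cformC x y : cform x y = cform y x. Proof. by rewrite /cform addrC. Qed.
Lemma cformDl x y z : cform (x + y) z = cform x z + cform y z.
Proof. by rewrite /cform eulerDl eulerDr addrACA. Qed.
Lemma cformZl x y (n : int) : cform (x *~ n) y = n * cform x y.
Proof. rewrite /cform eulerZl eulerZr; ring. Qed.
Lemma cformNl x y : cform (- x) y = - cform x y.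
Proof. by rewrite -mulrN1z cformZl mulN1r. Qed.
Lemma cformDr x y z : cform z (x + y) = cform z x + cform z y.
Proof. by rewrite !(cformC z) cformDl. Qed.
Lemma cformZr x y (n : int) : cform x (y *~ n) = n * cform x y.
Proof. by rewrite !(cformC x) cformZl. Qed.
Lemma cformNr x y : cform x (- y) = - cform x y.
Proof. by rewrite !(cformC x) cformNl. Qed.
Lemma cformxx x : cform x x = 2 * euler Q x x.
Proof. by rewrite /cform mulr_natl mulr2n. Qed.

Lemma cformE x y : cform x y =
  2 * \sum_i x i * y i
  - \sum_a (x (src Q a) * y (tgt Q a) + x (tgt Q a) * y (src Q a)).
Proof.
have -> : \sum_i x i * y i = \sum_i y i * x i by apply: eq_bigr => i _; rewrite mulrC.
rewrite /cform /euler big_split /=.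
have -> : \sum_a x (tgt Q a) * y (src Q a) = \sum_a y (src Q a) * x (tgt Q a).
  by apply: eq_bigr => i _; rewrite mulrC.
have -> : \sum_i x i * y i = \sum_i y i * x i by apply: eq_bigr => i _; rewrite mulrC.
ring.
Qed.

Lemma alphaE (i j : I) : alpha i j = (i == j)%:R :> int. Proof. by rewrite ffunE. Qed.

Lemma alpha_decomposition x : x = \sum_i alpha i *~ x i.
Proof.
apply/ffunP => j; rewrite sum_ffunE (bigD1 j) //= big1 ?addr0 => [|i ne].
  by rewrite ffunMzE alphaE eqxx intz.
by rewrite ffunMzE alphaE (negbTE ne) mul0rz.
Qed.

Lemma sum_alpha_l (i : I) (F : I -> int) : \sum_j alpha i j * F j = F i.
Proof.
rewrite (bigD1 i) //= big1 ?addr0 => [|j ne]; first by rewrite alphaE eqxx mul1r.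
by rewrite alphaE eq_sym (negbTE ne) mul0r.
Qed.

Definition loopless := forall a, src Q a != tgt Q a.

Lemma nedgesE i j : loopless -> (nedges Q i j)%:Z =
  \sum_a (alpha i (src Q a) * alpha j (tgt Q a) + alpha i (tgt Q a) * alpha j (src Q a)).
Proof.
move=> nl; rewrite /nedges -sum1_card big_mkcond /= (big_morph Posz PoszD (erefl _)).
apply: eq_bigr => a _; rewrite !alphaE inE.
rewrite !(eq_sym i) !(eq_sym j).
have : ~~ ((src Q a == i) && (tgt Q a == i)).
  by apply/andP => -[/eqP si /eqP ti]; have := nl a; rewrite si ti eqxx.
by case: (src Q a == i); case: (tgt Q a == i);
  case: (src Q a == j); case: (tgt Q a == j).
Qed.

Lemma cform_alpha i j : loopless -> cform (alpha i) (alpha j) = cartan Q i j.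
Proof.
move=> nl; rewrite cformE sum_alpha_l -nedgesE // /cartan alphaE eq_sym.
case: eqVneq => [->|_]; last by rewrite mulr0 add0r.
rewrite (_ : nedges Q j j = 0%N) ?subr0 //.
apply/eqP; rewrite cards_eq0; apply/set0Pn => -[a]; rewrite !inE orbb.
by case/andP => /eqP si /eqP ti; have := nl a; rewrite si ti eqxx.
Qed.

Lemma cartan_cform i x : loopless -> \sum_j cartan Q i j * x j = cform (alpha i) x.
Proof.
move=> nl; rewrite {2}(alpha_decomposition x).
rewrite (big_morph (cform (alpha i)) (id1 := 0) (op1 := +%R)); first last.
- by rewrite -[0](mulr0z (alpha i)) cformZr mul0r.
- by move=> y z; rewrite cformDr.
by apply: eq_bigr => j _; rewrite cformZr cform_alpha // mulrC.
Qed.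

Lemma refl_cform i x : loopless -> refl Q i x = x - alpha i *~ cform (alpha i) x.
Proof. by move=> nl; rewrite /refl cartan_cform. Qed.

Definition posdef := forall x, x != 0 -> 0 < euler Q x x.

Lemma dynkin_loopless : dynkin_quiver Q -> loopless.
Proof.
case=> n [e [f [ade [g fK gK] nE]]] a; apply/eqP => st.
have := nE (g (src Q a)) (g (src Q a)); rewrite gK.
have -> : e (g (src Q a)) (g (src Q a)) = false.
  move: (g (src Q a)) => i; have li := ltn_ord i.
  case: ade => -[h ->]; rewrite /path_graph /fork_graph; first by lia.
    by case: (i.+1 =P n); lia.
  by case: (i.+1 =P n); move: h; rewrite !inE; lia.
by apply/eqP; rewrite cards_eq0; apply/set0Pn; exists a; rewrite inE st eqxx.
Qed.

Lemma dynkin_nedges_le1 i j : dynkin_quiver Q -> (nedges Q i j <= 1)%N.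
Proof.
case=> n [e [f [ade [g fK gK] nE]]]; rewrite -(gK i) -(gK j) nE; by case: (e _ _).
Qed.

Lemma dynkin_posdef : dynkin_quiver Q -> posdef.
Proof.
move=> dQ x nx; have nl := dynkin_loopless dQ.
case: dQ => n [e [f [ade [g fK gK] nE]]].
have bf : bijective f by exists g.
have nz : exists i, x (f i) != 0.
  apply: NNPP => no; move/eqP: nx; apply; apply/ffunP => i; rewrite ffunE.
  by apply: NNPP => ni; apply: no; exists (g i); rewrite gK; apply/eqP.
have := ADE_posdef ade nz.
rewrite -(pmulr_rgt0 (euler Q x x) (_ : 0 < 2)) // -cformxx cformE.
have -> : \sum_i x i * x i = \sum_i x (f i) ^+ 2.
  by rewrite (reindex f) /=; [apply: eq_bigr => i _; rewrite expr2 | exact: onW_bij].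
suff -> : \sum_a (x (src Q a) * x (tgt Q a) + x (tgt Q a) * x (src Q a))
   = \sum_i \sum_j (e i j)%:Z * (x (f i) * x (f j)) by [].
have -> : \sum_i \sum_j (e i j)%:Z * (x (f i) * x (f j))
   = \sum_i \sum_j (nedges Q i j)%:Z * (x i * x j).
  rewrite [RHS](reindex f) /=; last exact: onW_bij.
  apply: eq_bigr => i _; rewrite [RHS](reindex f) /=; last exact: onW_bij.
  by apply: eq_bigr => j _; rewrite nE.
under [RHS]eq_bigr => i _ do under eq_bigr => j _ do rewrite nedgesE // mulr_suml.
under [RHS]eq_bigr => i _ do rewrite exchange_big.
rewrite [RHS]exchange_big; apply: eq_bigr => a _ /=.
set s := src Q a; set t := tgt Q a.
have sum2 (p q : I) : \sum_i \sum_j alpha i p * alpha j q * (x i * x j) = x p * x q.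
  transitivity (\sum_i alpha p i * (x i * x q)); last by rewrite sum_alpha_l.
  apply: eq_bigr => i _; rewrite -[x q](sum_alpha_l q) !mulr_sumr.
  by apply: eq_bigr => j _; rewrite !alphaE (eq_sym i) (eq_sym j); ring.
rewrite -(sum2 s t) -(sum2 t s) -big_split; apply: eq_bigr => i _.
by rewrite -big_split; apply: eq_bigr => j _ /=; rewrite mulrDl.
Qed.
End SymmetricForm.

(** * Roots of a positive definite quiver *)

Section RootSystem.
Variables (I A : finType) (Q : quiver I A).
Implicit Types x y z b c : root_lattice I.
Hypothesis nl : loopless Q.
Hypothesis pd : posdef Q.

Local Notation B := (cform Q).

Definition reflv b x : root_lattice I := x - b *~ B b x.

Lemma reflE i x : refl Q i x = reflv (alpha i) x.
Proof. exact: refl_cform. Qed.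

Lemma reflvD b x y : reflv b (x + y) = reflv b x + reflv b y.
Proof. by rewrite /reflv cformDr mulrzDr opprD addrACA. Qed.

Lemma reflvN b x : reflv b (- x) = - reflv b x.
Proof. by rewrite /reflv cformNr mulrNz opprD. Qed.

Lemma reflvNl b x : reflv (- b) x = reflv b x.
Proof. by rewrite /reflv cformNl mulNrNz. Qed.

Lemma reflv_orth b x : B b x = 0 -> reflv b x = x.
Proof. by rewrite /reflv => ->; rewrite mulr0z subr0. Qed.

Lemma reflv_self b : euler Q b b = 1 -> reflv b b = - b.
Proof.
move=> q1; rewrite /reflv cformxx q1 (_ : b *~ (2 * 1) = b + b) //.
by rewrite opprD addrA subrr add0r.
Qed.

Lemma reflvK b : euler Q b b = 1 -> involutive (reflv b).
Proof.
move=> q1 x; rewrite {1}/reflv {2}/reflv cformDr cformNr cformZr cformxx q1.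
have -> : B b x - B b x * (2 * 1) = - B b x by ring.
by rewrite mulrNz opprK subrK.
Qed.

Lemma cform_reflv b x y : euler Q b b = 1 ->
  B (reflv b x) (reflv b y) = B x y.
Proof.
move=> q1; rewrite /reflv !(cformDl, cformDr, cformNl, cformNr, cformZl, cformZr).
rewrite cformxx q1 (cformC Q x b); ring.
Qed.

Lemma euler_cform x y : B x x = B y y -> euler Q x x = euler Q y y.
Proof. by rewrite !cformxx; lia. Qed.

Lemma euler_alpha i : euler Q (alpha i) (alpha i) = 1.
Proof.
have : B (alpha i) (alpha i) = 2 by rewrite cform_alpha // /cartan eqxx.
by rewrite cformxx; lia.
Qed.

Lemma weyl_wordD s x y : weyl_word Q s (x + y) = weyl_word Q s x + weyl_word Q s y.
Proof. by elim: s => //= i s ->; rewrite !reflE reflvD. Qed.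

Lemma weyl_wordN s x : weyl_word Q s (- x) = - weyl_word Q s x.
Proof. by elim: s => //= i s ->; rewrite !reflE reflvN. Qed.

Lemma weyl_word0 s : weyl_word Q s 0 = 0.
Proof. by apply: (addrI (weyl_word Q s 0)); rewrite -weyl_wordD !addr0. Qed.

Lemma weyl_wordZ s x (n : int) : weyl_word Q s (x *~ n) = weyl_word Q s x *~ n.
Proof.
elim/int_ind: n => [|n IH|n IH]; first by rewrite !mulr0z weyl_word0.
  by rewrite -addn1 PoszD !mulrzDr weyl_wordD IH !mulr1z.
rewrite -addn1 PoszD opprD !mulrzDr weyl_wordD IH.
by rewrite !mulrN1z weyl_wordN.
Qed.

Lemma weyl_word_sum s (x : I -> root_lattice I) :
  weyl_word Q s (\sum_i x i) = \sum_i weyl_word Q s (x i).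
Proof. exact: (big_morph _ (weyl_wordD s) (weyl_word0 s)). Qed.

Lemma cform_weyl_word s x y : B (weyl_word Q s x) (weyl_word Q s y) = B x y.
Proof. by elim: s => //= i s IH; rewrite !reflE cform_reflv ?euler_alpha. Qed.

Lemma weyl_word_reflv s b x :
  weyl_word Q s (reflv b x) = reflv (weyl_word Q s b) (weyl_word Q s x).
Proof.
by rewrite /reflv weyl_wordD weyl_wordN weyl_wordZ cform_weyl_word.
Qed.

Lemma root_euler b : is_root Q b -> euler Q b b = 1.
Proof.
case=> s [i ->]; rewrite -(euler_alpha i); apply: euler_cform.
exact: cform_weyl_word.
Qed.

Lemma euler1_neq0 b : euler Q b b = 1 -> b != 0.
Proof.
by move=> q1; apply/eqP => b0; move: q1; rewrite b0 -(mulr0z 0) eulerZl mul0r.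
Qed.

Definition pos b := [forall i, 0 <= b i].

Lemma posP b : reflect (forall i, 0 <= b i) (pos b).
Proof. exact: forallP. Qed.

Lemma pos_alpha i : pos (alpha i).
Proof. by apply/posP => j; rewrite alphaE; case: eqP. Qed.

(** Write [b = p - m] with [p] and [m] nonnegative of disjoint supports.  Off the
    diagonal the form is nonpositive, so [<b, b> >= <p, p> + <m, m>], which is at
    least 2 unless [p] or [m] vanishes. *)
Lemma root_sign b : euler Q b b = 1 -> ~~ pos b -> pos (- b).
Proof.
move=> q1 /forallPn [i0]; rewrite -ltNge => neg0.
pose p : root_lattice I := [ffun i => Num.max (b i) 0].
pose m : root_lattice I := [ffun i => Num.max (- b i) 0].
have bE : b = p - m by apply/ffunP => i; rewrite !ffunE; lia.
have m0 : m != 0.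
  by apply/eqP => /ffunP /(_ i0); rewrite !ffunE; lia.
have pm : B p m <= 0.
  rewrite cformE big1 ?mulr0 ?sub0r ?oppr_le0 => [|i _]; last by rewrite !ffunE; nia.
  by apply: sumr_ge0 => a _; rewrite !ffunE addr_ge0 // mulr_ge0 //; lia.
have [p0|p0] := eqVneq p 0.
  by apply/posP => i; rewrite bE p0 sub0r opprK !ffunE; lia.
have := pd p0; have := pd m0; move: q1.
rewrite bE eulerDl !eulerDr !eulerNl !eulerNr.
by move: pm; rewrite /cform; lia.
Qed.

Lemma posN b : b != 0 -> pos b -> ~~ pos (- b).
Proof.
move=> nb /posP pb; apply/negP => /posP nb'; move/eqP: nb; apply; apply/ffunP => i.
have := pb i; have := nb' i; rewrite !ffunE oppr_ge0 => h1 h2.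
by apply: le_anti; rewrite h1 h2.
Qed.

(** The reflection only changes the coordinate at [i]; by [root_sign] all the
    other coordinates of [b] vanish. *)
Lemma refl_flip i b : euler Q b b = 1 -> pos b -> ~~ pos (refl Q i b) -> b = alpha i.
Proof.
move=> q1 /posP pb; rewrite reflE => np.
have qr : euler Q (reflv (alpha i) b) (reflv (alpha i) b) = 1.
  by rewrite -q1; apply: euler_cform; rewrite cform_reflv ?euler_alpha.
have /posP nr := root_sign qr np.
have b0 j : i != j -> b j = 0.
  move=> ne; have := pb j; have := nr j.
  rewrite !ffunE ffunMzE alphaE (negbTE ne) mul0rz subr0 oppr_ge0 => h1 h2.
  by apply: le_anti; rewrite h1 h2.
have bE : b = alpha i *~ b i.
  apply/ffunP => j; rewrite ffunMzE alphaE.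
  by case: eqVneq => [<-|/b0 ->]; rewrite ?intz ?mul0rz.
rewrite bE; move: q1; rewrite bE eulerZl eulerZr euler_alpha.
have := pb i; rewrite ffunMzE alphaE eqxx intz => p1 q1.
by rewrite (_ : b i = 1) ?mulr1z //; nia.
Qed.

(** If [b - c = 3 z] then [9 <z, z> = <b - c, b - c> <= 4], as
    [<b + c, b + c> >= 0]; hence [z = 0]. *)
Lemma root_mod3_inj b c : euler Q b b = 1 -> euler Q c c = 1 ->
  (forall i, (3 %| b i - c i)%Z) -> b = c.
Proof.
move=> qb qc h; apply/eqP; rewrite -subr_eq0; apply/eqP.
pose z : root_lattice I := [ffun i => ((b i - c i) %/ 3)%Z].
have bE : b - c = z *~ 3.
  apply/ffunP => i; rewrite ffunMzE !ffunE.
  by rewrite -mulrzr intz divzK.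
have [e|z0] := eqVneq z 0; first by rewrite bE e mul0rz.
have := pd z0; have := congr1 (fun x => euler Q x x) bE.
rewrite eulerZl eulerZr eulerDl !eulerDr !eulerNl !eulerNr qb qc.
have : 0 <= euler Q (b + c) (b + c).
  have [->|] := eqVneq (b + c) 0; last by move/pd/ltW.
  by have := eulerZl Q 0 0 0; rewrite mul0r mulr0z => ->.
rewrite eulerDl !eulerDr qb qc; lia.
Qed.

Lemma roots_finite (s : seq (root_lattice I)) : uniq s ->
  (forall b, b \in s -> euler Q b b = 1) -> (size s <= 3 ^ #|I|)%N.
Proof.
move=> us hs.
pose r b : {ffun I -> 'I_3} := [ffun i => inord (absz (b i %% 3)%Z)].
have ur : uniq (map r s).
  rewrite map_inj_in_uniq // => b c bs cs /ffunP rbc.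
  apply: root_mod3_inj => //; try exact: hs.
  move=> i; have := congr1 val (rbc i); rewrite !ffunE /= !inordK; last 2 first.
  - by have := ltz_mod (b i) (isT : 3 != 0 :> int); have := modz_ge0 (b i) (isT : 3 != 0 :> int); lia.
  - by have := ltz_mod (c i) (isT : 3 != 0 :> int); have := modz_ge0 (c i) (isT : 3 != 0 :> int); lia.
  move=> e; rewrite -eqz_mod_dvd; apply/eqP.
  have := modz_ge0 (b i) (isT : 3 != 0 :> int).
  by have := modz_ge0 (c i) (isT : 3 != 0 :> int); lia.
by rewrite -(size_map r) -(card_uniqP ur) -[3%N in leqRHS]card_ord -card_ffun max_card.
Qed.

End RootSystem.

(** * The involution and the restricted reflections *)

(** What the argument uses of a Dynkin iquiver.  Unlike the list of the diagrams,
    these properties are visibly stable under reflections. *)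
Record definite_iquiver (I A : finType) (Q : quiver I A)
    (tau : I -> I) (tauA : A -> A) : Prop := DefiniteIquiver {
  di_loopless : loopless Q;
  di_posdef : posdef Q;
  di_src : forall a, src Q (tauA a) = tau (src Q a);
  di_tgt : forall a, tgt Q (tauA a) = tau (tgt Q a);
  di_tauK : involutive tau;
  di_tauAK : involutive tauA;
  di_orth : forall i, tau i != i -> cform Q (alpha i) (alpha (tau i)) = 0 }.

Section Involution.
Variables (I A : finType) (tau : I -> I) (tauA : A -> A) (Q : quiver I A).
Implicit Types x y z b c : root_lattice I.
Hypothesis HQ : definite_iquiver Q tau tauA.
Let nl := di_loopless HQ.
Let pd := di_posdef HQ.
Let tauK := di_tauK HQ.
Let orth := di_orth HQ.
Local Notation T := (tau_act tau).
Local Notation br := (brefl Q tau).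
Local Notation bw := (brefl_word Q tau).

Lemma tau_actE x i : T x i = x (tau i).
Proof.
rewrite sum_ffunE (bigD1 (tau i)) //= big1 ?addr0 => [|j ne].
  by rewrite ffunMzE alphaE tauK eqxx intz.
rewrite ffunMzE alphaE (_ : (tau j == i) = false) ?mul0rz //.
by apply: contraNF ne => /eqP <-; rewrite tauK.
Qed.

Lemma tau_actK : involutive T.
Proof. by move=> x; apply/ffunP => i; rewrite !tau_actE tauK. Qed.

Lemma tau_actN x : T (- x) = - T x.
Proof. by apply/ffunP => i; rewrite !(tau_actE, ffunE). Qed.

Lemma tau_act_alpha i : T (alpha i) = alpha (tau i).
Proof.
by apply/ffunP => j; rewrite tau_actE !alphaE (can2_eq tauK tauK).
Qed.

Lemma tau_euler x y : euler Q (T x) (T y) = euler Q x y.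
Proof.
rewrite /euler [in RHS](reindex_inj (can_inj tauK)).
rewrite [X in _ = _ - X](reindex_inj (can_inj (di_tauAK HQ))) /=.
congr (_ - _); first by apply: eq_bigr => i _; rewrite !tau_actE.
by apply: eq_bigr => a _; rewrite !tau_actE (di_src HQ) (di_tgt HQ).
Qed.

Lemma tau_cform x y : cform Q (T x) (T y) = cform Q x y.
Proof. by rewrite /cform !tau_euler. Qed.

Lemma tau_reflv b x : T (reflv Q b x) = reflv Q (T b) (T x).
Proof.
rewrite /reflv tau_cform; apply/ffunP => i.
by rewrite !(tau_actE, ffunE, ffunMzE).
Qed.

Lemma tau_pos b : pos (T b) = pos b.
Proof.
apply/posP/posP => h i; last by rewrite tau_actE.
by have := h (tau i); rewrite tau_actE tauK.
Qed.

Lemma reflvC b c x : cform Q b c = 0 ->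
  reflv Q b (reflv Q c x) = reflv Q c (reflv Q b x).
Proof.
move=> o; rewrite /reflv !cformDr !cformNr !cformZr o (cformC _ c b) o.
by rewrite !mulr0 !subr0 addrAC.
Qed.

Lemma breflE i x : br i x = if tau i == i then reflv Q (alpha i) x
  else reflv Q (alpha i) (reflv Q (alpha (tau i)) x).
Proof. by rewrite /brefl !reflE. Qed.

Lemma brefl_tau i x : br (tau i) x = br i x.
Proof.
rewrite !breflE tauK eq_sym; case: eqP => [e|/eqP ne]; first by rewrite e.
by rewrite reflvC // cformC orth // eq_sym.
Qed.

Lemma tau_brefl i x : T (br i x) = br i (T x).
Proof.
rewrite -[in RHS]brefl_tau !breflE tauK eq_sym.
by case: eqP => _; rewrite !tau_reflv !tau_act_alpha ?tauK.
Qed.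

Lemma breflN i x : br i (- x) = - br i x.
Proof. by rewrite !breflE; case: eqP => _; rewrite !reflvN. Qed.

Lemma breflK i : involutive (br i).
Proof.
move=> x; rewrite !breflE; case: eqP => [_|/eqP ne]; first by rewrite reflvK ?euler_alpha.
have o : cform Q (alpha i) (alpha (tau i)) = 0 by exact: orth.
by rewrite reflvC // reflvK ?euler_alpha // reflvK ?euler_alpha.
Qed.

Lemma brefl_alpha i : br i (alpha i) = - alpha i.
Proof.
rewrite breflE; case: eqP => [_|/eqP ne]; first by rewrite reflv_self ?euler_alpha.
by rewrite [X in reflv _ _ X]reflv_orth ?reflv_self ?euler_alpha // cformC orth.
Qed.

Lemma brefl_alpha_tau i : br i (alpha (tau i)) = - alpha (tau i).
Proof. by rewrite -brefl_tau brefl_alpha. Qed.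

Lemma cform_brefl i x y : cform Q (br i x) (br i y) = cform Q x y.
Proof. by rewrite !breflE; case: eqP => _; rewrite !cform_reflv ?euler_alpha. Qed.

Lemma euler1_brefl i b : euler Q b b = 1 -> euler Q (br i b) (br i b) = 1.
Proof. by move=> <-; apply: euler_cform; rewrite cform_brefl. Qed.

Lemma brefl_flip i b : euler Q b b = 1 -> pos b -> ~~ pos (br i b) ->
  b = alpha i \/ b = alpha (tau i).
Proof.
move=> q1 pb; rewrite /brefl; case: eqP => [_|/eqP ne].
  by move=> h; left; exact: (refl_flip nl pd q1 pb h).
have q1' : euler Q (refl Q (tau i) b) (refl Q (tau i) b) = 1.
  by rewrite -q1; apply: euler_cform; rewrite !reflE // cform_reflv ?euler_alpha.
have [pc h|nc _] := boolP (pos (refl Q (tau i) b)); last first.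
  by right; exact: (refl_flip nl pd q1 pb nc).
left; have := refl_flip nl pd q1' pc h; rewrite reflE // => e.
rewrite -[b](reflvK (euler_alpha nl (tau i))) e.
by rewrite reflv_orth // cformC orth.
Qed.

Definition unfold_word (s : seq I) : seq I :=
  flatten [seq if tau i == i then [:: i] else [:: i; tau i] | i <- s].

Lemma brefl_wordE s x : bw s x = weyl_word Q (unfold_word s) x.
Proof.
elim: s => //= i s ->; rewrite /brefl /unfold_word /weyl_word /=.
by case: eqP => _; rewrite foldr_cat.
Qed.

Lemma brefl_word_cat s t x : bw (s ++ t) x = bw s (bw t x).
Proof. by rewrite /brefl_word foldr_cat. Qed.

Lemma brefl_word_rcons s i x : bw (rcons s i) x = bw s (br i x).
Proof. by rewrite -cats1 brefl_word_cat. Qed.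

Lemma brefl_wordN s x : bw s (- x) = - bw s x.
Proof. by rewrite !brefl_wordE weyl_wordN. Qed.

Lemma tau_brefl_word s x : T (bw s x) = bw s (T x).
Proof. by elim: s => //= i s <-; rewrite tau_brefl. Qed.

Lemma brefl_wordK s x : bw (rev s) (bw s x) = x.
Proof.
elim: s x => //= i s IH x.
by rewrite rev_cons brefl_word_rcons breflK IH.
Qed.

Lemma brefl_wordVK s x : bw s (bw (rev s) x) = x.
Proof. by have := brefl_wordK (rev s) x; rewrite revK. Qed.

Lemma euler1_brefl_word s b : euler Q b b = 1 -> euler Q (bw s b) (bw s b) = 1.
Proof.
by move=> <-; apply: euler_cform; rewrite !brefl_wordE cform_weyl_word.
Qed.

Lemma brefl_word_root s b : is_root Q b -> is_root Q (bw s b).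
Proof.
case=> t [i ->]; exists (unfold_word s ++ t), i.
by rewrite brefl_wordE /weyl_word foldr_cat.
Qed.

Lemma brefl_word_in_Wtau s : in_Wtau Q tau (bw s).
Proof.
split; last by move=> x; exact: tau_brefl_word.
by exists (unfold_word s) => x; exact: brefl_wordE.
Qed.

Lemma brefl_word_sum_alpha s x : bw s x = \sum_i bw s (alpha i) *~ x i.
Proof.
rewrite {1}(alpha_decomposition x) brefl_wordE weyl_word_sum //.
by apply: eq_bigr => i _; rewrite weyl_wordZ // -brefl_wordE.
Qed.

(** The relation of defining the same restricted reflection, for roots: an orbit of
    [tau] up to sign. *)
Definition tau_line b c :=
  [|| b == c, b == - c, b == T c | b == - T c].

Lemma tau_line_trans b b' c : tau_line b c -> tau_line b' c -> tau_line b b'.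
Proof.
by case/or4P => /eqP ->; case/or4P => /eqP ->;
  rewrite /tau_line ?(tau_actN, tau_actK, opprK) eqxx ?orbT.
Qed.

Lemma tau_line_sym b c : tau_line b c -> tau_line c b.
Proof.
by case/or4P => /eqP ->; rewrite /tau_line ?(tau_actN, tau_actK, opprK) eqxx ?orbT.
Qed.

Lemma tau_line_brefl i b c : tau_line (br i b) (br i c) = tau_line b c.
Proof.
by rewrite /tau_line tau_brefl -!breflN !(inj_eq (can_inj (breflK i))).
Qed.

(** A reflection conjugated by an isometry is the reflection in the image of the
    root; for a two-element orbit the two commuting factors are carried along
    together, because the isometry commutes with [tau]. *)
Lemma brefl_word_conj s i k : tau_line (bw s (alpha i)) (alpha k) ->
  forall x, bw s (br i x) = br k (bw s x).
Proof.
move=> line x.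
have tw : bw s (alpha (tau i)) = T (bw s (alpha i)).
  by rewrite tau_brefl_word tau_act_alpha.
have fixE : (tau i == i) = (tau k == k).
  have inj : injective (bw s) := can_inj (brefl_wordK s).
  have alpha_inj : injective (@alpha I).
    move=> p q /ffunP /(_ p); rewrite !alphaE eqxx.
    by case: eqVneq => // e _; rewrite e.
  rewrite -(inj_eq alpha_inj) -(inj_eq inj) tw.
  rewrite -[in RHS](inj_eq alpha_inj) -tau_act_alpha.
  case/or4P: line => /eqP ->; rewrite ?tau_actN ?eqr_opp ?tau_actK //.
have reflvw b y : bw s (reflv Q b y) = reflv Q (bw s b) (bw s y).
  by rewrite !brefl_wordE weyl_word_reflv.
rewrite !breflE fixE; case: eqP => [e|/eqP ne]; rewrite !reflvw ?tw.
  case/or4P: line => /eqP ->; rewrite ?reflvNl // tau_act_alpha e //.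
case/or4P: line => /eqP ->; rewrite ?tau_actN ?reflvNl ?tau_actK ?tau_act_alpha //.
  by rewrite reflvC // cformC orth.
by rewrite reflvC // cformC orth.
Qed.
End Involution.

(** * Reflecting a quiver at sinks *)

Section Reflection.
Variables (I A : finType) (tau : I -> I).
Implicit Types (Q : quiver I A) (x y z b c : root_lattice I).

Lemma cform_reflect Q l x y :
  cform (reflect_quiver tau l Q) x y = cform Q x y.
Proof.
rewrite !cformE; congr (_ - _); apply: eq_bigr => a _ /=.
by case: ifP => _ //; rewrite addrC.
Qed.

Lemma loopless_reflect Q l : loopless Q -> loopless (reflect_quiver tau l Q).
Proof. by move=> nl a /=; case: ifP => _; rewrite // eq_sym. Qed.

Lemma posdef_reflect Q l : posdef Q -> posdef (reflect_quiver tau l Q).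
Proof.
move=> pd x /pd; have := cformxx (reflect_quiver tau l Q) x.
by rewrite cform_reflect cformxx; lia.
Qed.

Lemma euler_sink_l Q l x : sink Q l -> euler Q (alpha l) x = x l.
Proof.
move=> /forallP sl; rewrite /euler sum_alpha_l big1 ?subr0 // => a _.
by rewrite alphaE eq_sym (negbTE (sl a)) mul0r.
Qed.

Lemma euler_sink_r Q l x : sink Q l -> euler Q x (alpha l) = - reflv Q (alpha l) x l.
Proof.
move=> sl; rewrite /reflv /cform euler_sink_l // !ffunE ffunMzE alphaE eqxx.
by rewrite intz; ring.
Qed.

(** Both sides differ from [<x, y>] by terms in [x l], [y l] and the sums [S] of
    [x] and [y] over the neighbours of the sink [l]. *)
Lemma euler_reflect1 Q l x y : loopless Q -> sink Q l ->
  euler Q (reflv Q (alpha l) x) (reflv Q (alpha l) y)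
  = euler (reflect_quiver id l Q) x y.
Proof.
move=> nl sl.
pose S z := \sum_(a | tgt Q a == l) z (src Q a).
have eS z : euler Q z (alpha l) = z l - S z.
  rewrite /euler /S [in RHS]big_mkcond; congr (_ - _).
    by rewrite -(sum_alpha_l l z); apply: eq_bigr => i _; rewrite mulrC.
  apply: eq_bigr => a _; rewrite alphaE eq_sym; case: eqP => _; by rewrite ?mulr1 ?mulr0.
have -> : euler (reflect_quiver id l Q) x y = euler Q x y + S x * y l - x l * S y.
  pose Q' := reflect_quiver id l Q.
  have e : \sum_a x (src Q' a) * y (tgt Q' a) =
      \sum_a x (src Q a) * y (tgt Q a) + x l * S y - S x * y l.
    rewrite /S mulr_sumr mulr_suml [X in _ + X - _]big_mkcond [X in _ - X]big_mkcond /=.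
    rewrite -big_split -sumrB /=; apply: eq_bigr => a _.
    by rewrite orbb; case: eqP => [->|_]; ring.
  rewrite /euler e; ring.
rewrite /reflv /cform !(eulerDl, eulerDr, eulerNl, eulerNr, eulerZl, eulerZr).
rewrite (euler_alpha nl) !(euler_sink_l _ sl) !eS; ring.
Qed.

Lemma sink_tau Q (tauA : A -> A) l : definite_iquiver Q tau tauA ->
  sink Q l -> sink Q (tau l).
Proof.
move=> HQ /forallP sl; apply/forallP => a; apply/eqP => e.
have := sl (tauA a); rewrite (di_src HQ) e (di_tauK HQ) eqxx //.
Qed.

Lemma reflv_reflect Q l b x : reflv (reflect_quiver tau l Q) b x = reflv Q b x.
Proof. by rewrite /reflv cform_reflect. Qed.

End Reflection.

Section IteratedReflection.
Variables (I A : finType) (tau : I -> I) (tauA : A -> A).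
Implicit Types (Q : quiver I A) (x y z b c : root_lattice I).

(** When [tau l != l], both vertices are sinks, and reversing the arrows at one
    does not affect those at the other. *)
Lemma euler_reflect Q l x y : definite_iquiver Q tau tauA -> sink Q l ->
  euler Q (brefl Q tau l x) (brefl Q tau l y) = euler (reflect_quiver tau l Q) x y.
Proof.
move=> HQ sl; have nl := di_loopless HQ; have stl := sink_tau HQ sl.
have ext Q1 Q2 : src Q1 =1 src Q2 -> tgt Q1 =1 tgt Q2 ->
    euler Q1 x y = euler Q2 x y.
  by move=> es et; rewrite /euler; congr (_ - _); apply: eq_bigr => a _; rewrite es et.
rewrite !(breflE HQ); case: eqP => [e|/eqP ne].
  by rewrite euler_reflect1 //; apply: ext => a /=; rewrite ?e.
rewrite euler_reflect1 // -!(reflv_reflect id Q l) euler_reflect1; last 2 first.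
- exact: loopless_reflect.
- apply/forallP => a /=; rewrite orbb; case: ifP => [/eqP ->|_]; first by rewrite eq_sym.
  exact: (forallP stl).
have sa := forallP stl.
apply: ext => a /=; rewrite !orbb; case: (tgt Q a =P l) => [e|nel] /=.
- by rewrite (negbTE (sa a)).
- by [].
- by rewrite (negbTE (sa a)).
by [].
Qed.

Lemma definite_reflect Q l : definite_iquiver Q tau tauA ->
  definite_iquiver (reflect_quiver tau l Q) tau tauA.
Proof.
move=> HQ; have tauK := di_tauK HQ.
have rev a : (tau (tgt Q a) == l) || (tau (tgt Q a) == tau l) =
  (tgt Q a == l) || (tgt Q a == tau l).
  by rewrite (inj_eq (can_inj tauK)) (can2_eq tauK tauK) orbC.
split.
- exact: loopless_reflect (di_loopless HQ).
- exact: posdef_reflect (di_posdef HQ).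
- by move=> a /=; rewrite (di_src HQ) (di_tgt HQ) rev; case: ifP.
- by move=> a /=; rewrite (di_src HQ) (di_tgt HQ) rev; case: ifP.
- exact: tauK.
- exact: di_tauAK HQ.
by move=> i ne; rewrite cform_reflect (di_orth HQ).
Qed.

Definition reflects Q (s : seq I) := foldl (fun Q i => reflect_quiver tau i Q) Q s.

Lemma definite_reflects Q s : definite_iquiver Q tau tauA ->
  definite_iquiver (reflects Q s) tau tauA.
Proof. by elim: s Q => //= i s IH Q HQ; apply: IH; apply: definite_reflect. Qed.

Lemma iadmissible_rcons Q s i :
  iadmissible tau Q (rcons s i) = iadmissible tau Q s && sink (reflects Q s) i.
Proof. by elim: s Q => [|j s IH] Q /=; rewrite ?andbT // IH andbA. Qed.

Lemma cform_reflects Q s x y : cform (reflects Q s) x y = cform Q x y.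
Proof. by elim: s Q => //= i s IH Q; rewrite IH cform_reflect. Qed.

Lemma reflv_reflects Q s b x : reflv (reflects Q s) b x = reflv Q b x.
Proof. by rewrite /reflv cform_reflects. Qed.

Lemma brefl_reflect Q l i x : definite_iquiver Q tau tauA ->
  brefl (reflect_quiver tau l Q) tau i x = brefl Q tau i x.
Proof.
move=> HQ; rewrite (breflE HQ) (breflE (definite_reflect l HQ)).
by rewrite !reflv_reflect.
Qed.

Lemma brefl_word_reflect Q l s x : definite_iquiver Q tau tauA ->
  brefl_word (reflect_quiver tau l Q) tau s x = brefl_word Q tau s x.
Proof.
move=> HQ; elim: s => [//|i s IH].
have step Q' : brefl_word Q' tau (i :: s) x = brefl Q' tau i (brefl_word Q' tau s x).
  by [].
by rewrite !step IH brefl_reflect.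
Qed.

Lemma euler_reflects Q s x y : definite_iquiver Q tau tauA -> iadmissible tau Q s ->
  euler Q (brefl_word Q tau s x) (brefl_word Q tau s y) = euler (reflects Q s) x y.
Proof.
elim: s Q => //= i s IH Q HQ /andP [si adm].
by rewrite euler_reflect // -IH ?(brefl_word_reflect i s) //; exact: definite_reflect.
Qed.
End IteratedReflection.

(** * The roots listed by a word *)

Section AdmissibleSequence.
Variables (I A : finType) (tau : I -> I) (tauA : A -> A) (Q : quiver I A).
Implicit Types (x y z b c : root_lattice I) (s t : seq I).
Hypothesis HQ : definite_iquiver Q tau tauA.
Let nl := di_loopless HQ.
Let pd := di_posdef HQ.
Local Notation T := (tau_act tau).
Local Notation br := (brefl Q tau).
Local Notation bw := (brefl_word Q tau).
Local Notation winv s := (brefl_word Q tau (rev s)).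
Local Notation q b := (euler Q b b).

Fixpoint betas s : seq (root_lattice I) :=
  if s is i :: s' then alpha i :: map (br i) (betas s') else [::].

Definition tau_orbit b := if T b == b then [:: b] else [:: b; T b].
Definition beta_list s := flatten (map tau_orbit (betas s)).

Lemma size_betas s : size (betas s) = size s.
Proof. by elim: s => //= i s IH; rewrite size_map IH. Qed.

Lemma betas_rcons s i : betas (rcons s i) = rcons (betas s) (bw s (alpha i)).
Proof. by elim: s => //= j s ->; rewrite map_rcons. Qed.

Lemma nth_betas s j i0 : (j < size s)%N ->
  nth 0 (betas s) j = bw (take j s) (alpha (nth i0 s j)).
Proof.
elim: s j => [|i s IH] [|j] //=; rewrite ltnS => lt.
by rewrite (nth_map 0) ?size_betas // IH.
Qed.

Lemma beta_listP s b : reflect (exists2 c, c \in betas s & b = c \/ b = T c)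
  (b \in beta_list s).
Proof.
apply: (iffP flattenP) => [[_ /mapP[c cs ->]]|[c cs bc]].
  rewrite /tau_orbit; case: eqP => _; rewrite !inE.
    by move/eqP => ->; exists c => //; left.
  by case/orP => /eqP ->; exists c => //; [left|right].
exists (tau_orbit c); first exact: map_f.
rewrite /tau_orbit; case: eqP => [e|_]; rewrite !inE.
  by case: bc => ->; rewrite ?e.
by case: bc => ->; rewrite eqxx ?orbT.
Qed.

Lemma beta_list_rcons s i :
  beta_list (rcons s i) = beta_list s ++ tau_orbit (bw s (alpha i)).
Proof. by rewrite /beta_list betas_rcons map_rcons -cats1 flatten_cat /= cats0. Qed.

Lemma beta_seqE n (s : n.-tuple I) : beta_seq Q tau s = beta_list s.
Proof.
rewrite /beta_seq /beta_list; congr flatten.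
have size_s := size_tuple s.
apply: (@eq_from_nth _ [::]); first by rewrite size_map [RHS]size_map size_enum_ord size_betas size_s.
move=> j; rewrite size_map size_enum_ord => lt.
pose jo := Ordinal lt.
rewrite (nth_map jo) ?size_enum_ord // (nth_map 0) ?size_betas ?size_s //.
rewrite (nth_ord_enum jo jo) (nth_betas (tnth_default s jo)) ?size_s //.
Qed.

Lemma betas_split s b : b \in betas s ->
  exists u i v, s = u ++ i :: v /\ b = bw u (alpha i).
Proof.
elim: s b => //= i s IH b; rewrite inE => /orP [/eqP ->|/mapP [c /IH [u [j [v [-> ->]]]] ->]].
  by exists [::], i, s.
by exists (i :: u), j, v.
Qed.

Lemma beta_list_split s b : b \in beta_list s -> exists u i, b = bw u (alpha i).
Proof.
case/beta_listP => c /betas_split [u [i [v [_ ->]]]] [->|->]; first by exists u, i.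
by exists u, (tau i); rewrite (tau_brefl_word HQ) (tau_act_alpha HQ).
Qed.

Lemma beta_list_root s b : b \in beta_list s -> is_root Q b.
Proof.
case/beta_list_split => u [i ->].
by apply: brefl_word_root; exists [::], i.
Qed.

Lemma beta_list_q s b : b \in beta_list s -> q b = 1.
Proof. by move/beta_list_root/(root_euler nl). Qed.

Lemma betas_sub s b : b \in betas s -> b \in beta_list s.
Proof. by move=> bs; apply/beta_listP; exists b => //; left. Qed.

Lemma beta_list_tau s b : b \in beta_list s -> T b \in beta_list s.
Proof.
case/beta_listP => c cs bc; apply/beta_listP; exists c => //.
by case: bc => ->; [right|left; rewrite (tau_actK HQ)].
Qed.

Lemma winv_cons i s b : winv (i :: s) b = winv s (br i b).
Proof. by rewrite rev_cons brefl_word_rcons. Qed.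

Lemma winv_rcons i s b : winv (rcons s i) b = br i (winv s b).
Proof. by rewrite rev_rcons. Qed.

Lemma not_pos_opp b : q b = 1 -> pos b -> pos (- b) -> False.
Proof. by move=> /euler1_neq0 nb pb; apply/negP; exact: posN. Qed.

(** Applying the reflections one at a time, the sign changes at some step, and
    there the root is simple. *)
Lemma inverted_in_beta_list s b :
  q b = 1 -> pos b -> ~~ pos (winv s b) -> b \in beta_list s.
Proof.
elim: s b => [|i s IH] b q1 pb; first by rewrite pb.
rewrite winv_cons => ni; have [pc|nc] := boolP (pos (br i b)); last first.
  have [->|->] := brefl_flip HQ q1 pb nc.
    by apply: betas_sub; rewrite inE eqxx.
  by rewrite -(tau_act_alpha HQ); apply/beta_list_tau/betas_sub; rewrite inE eqxx.
have /beta_listP [c cs bc] := IH _ (euler1_brefl HQ i q1) pc ni.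
apply/beta_listP; exists (br i c); first by rewrite inE map_f ?orbT.
by case: bc => e; [left|right]; rewrite ?(tau_brefl HQ) -e (breflK HQ).
Qed.

Lemma pos_beta_list s b : all (@pos I) (betas s) -> b \in beta_list s -> pos b.
Proof.
by move=> /allP ps /beta_listP [c /ps pc] [->|->] //; rewrite (tau_pos HQ).
Qed.

(** A root that has become negative stays so: if the next reflection made it
    positive again, it would be, up to [tau], the opposite of the root that this
    reflection lists, which is positive. *)
Lemma brefl_winv_neg s i b : q b = 1 -> pos b -> pos (bw s (alpha i)) ->
  ~~ pos (winv s b) -> ~~ pos (br i (winv s b)).
Proof.
move=> q1 pb pw nw; apply/negP => pbr.
have qw := euler1_brefl_word HQ (rev s) q1.
have pc : pos (- winv s b) := root_sign pd qw nw.
have qc : q (- winv s b) = 1 by rewrite eulerNl eulerNr opprK.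
have : ~~ pos (br i (- winv s b)).
  rewrite (breflN HQ); apply: posN => //.
  exact/euler1_neq0/(euler1_brefl HQ).
move=> /(brefl_flip HQ qc pc) e.
apply: (not_pos_opp q1 pb); rewrite -[b](brefl_wordVK HQ s) -(brefl_wordN HQ).
case: e => -> //; rewrite -(tau_act_alpha HQ) -(tau_brefl_word HQ).
by rewrite (tau_pos HQ).
Qed.

Lemma beta_list_inverted s b :
  all (@pos I) (betas s) -> b \in beta_list s -> ~~ pos (winv s b).
Proof.
elim/last_ind: s b => // s i IH b.
rewrite betas_rcons all_rcons beta_list_rcons mem_cat => /andP [pw ps] /orP [bs|].
  rewrite winv_rcons; apply: brefl_winv_neg => //; first exact: beta_list_q bs.
    exact: pos_beta_list bs.
  exact: IH.
have neg j : ~~ pos (- alpha j : root_lattice I).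
  exact/posN/pos_alpha/euler1_neq0/euler_alpha.
rewrite winv_rcons => bo.
have [->|->] : b = bw s (alpha i) \/ b = bw s (alpha (tau i)).
  rewrite -(tau_act_alpha HQ) -(tau_brefl_word HQ).
  move: bo; rewrite /tau_orbit; case: ifP => _; rewrite !inE; first by move/eqP; left.
  by case/orP => /eqP; [left|right].
  by rewrite (brefl_wordK HQ) (brefl_alpha HQ).
by rewrite (brefl_wordK HQ) (brefl_alpha_tau HQ).
Qed.

(** A root [b] of the list becomes, on the quiver reflected up to the step at
    which [b] is listed, the simple root at a sink [l], and [c] becomes a positive
    root [y].  There [<alpha l, y> = y l], and [<y, alpha l>] is the opposite of
    the coordinate at [l] of the reflected root, which is positive because [y] is
    not [alpha l]. *)
Lemma euler_inverted s b c : iadmissible tau Q s -> all (@pos I) (betas s) ->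
  q c = 1 -> pos c -> pos (winv s c) -> b \in beta_list s ->
  euler Q c b <= 0 /\ 0 <= euler Q b c.
Proof.
elim/last_ind: s => // s i IH.
rewrite iadmissible_rcons betas_rcons all_rcons beta_list_rcons mem_cat winv_rcons.
move=> /andP [adm si] /andP [pw ps] qc pc pbr.
have pwc : pos (winv s c).
  apply: contraLR pbr => nw; exact: brefl_winv_neg.
case/orP => [bs|bo]; first exact: IH.
pose Q' := reflects tau Q s.
have HQ' : definite_iquiver Q' tau tauA := definite_reflects s HQ.
set y := winv s c in pbr pwc.
have qy : q y = 1 by exact: (euler1_brefl_word HQ).
have cE : c = bw s y by rewrite (brefl_wordVK HQ).
have key l : sink Q' l -> br l =1 br i -> b = bw s (alpha l) ->
    euler Q c b <= 0 /\ 0 <= euler Q b c.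
  move=> sl bri ->; rewrite cE !(euler_reflects _ _ HQ adm).
  rewrite (euler_sink_l _ sl) (euler_sink_r _ sl); split; last exact: (posP _ pwc).
  rewrite oppr_le0; rewrite reflv_reflects.
  have [/posP pr|nr] := boolP (pos (refl Q l y)); first by rewrite -reflE.
  have e := refl_flip nl pd qy pwc nr.
  move: pbr; rewrite -bri e (brefl_alpha HQ).
  by move/(not_pos_opp (euler_alpha nl l) (pos_alpha l)).
have [|] : b = bw s (alpha i) \/ b = bw s (alpha (tau i)).
- rewrite -(tau_act_alpha HQ) -(tau_brefl_word HQ).
  move: bo; rewrite /tau_orbit; case: ifP => _; rewrite !inE; first by move/eqP; left.
  by case/orP => /eqP; [left|right].
- exact: key.
by apply: key; [exact: sink_tau HQ' si | exact: brefl_tau HQ i].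
Qed.

(** The set [S] of the vertices whose images are positive is closed under following
    the arrows of the reflected quiver: for an arrow from [i] in [S] to [j] not in
    [S], the opposite of the image of [alpha j] would be a listed root, and
    [euler_inverted] would contradict that [<alpha i, alpha j>] is negative.
    Without a sink in [S], there would be at least as many arrows inside [S] as
    vertices, and the indicator of [S] would have a nonpositive Euler form. *)
Lemma next_sink_exists s b : iadmissible tau Q s -> all (@pos I) (betas s) ->
  q b = 1 -> pos b -> b \notin beta_list s ->
  exists2 i, sink (reflects tau Q s) i & pos (bw s (alpha i)).
Proof.
move=> adm ps qb pb nb.
pose Q' := reflects tau Q s.
have HQ' : definite_iquiver Q' tau tauA := definite_reflects s HQ.
have nl' := di_loopless HQ'; have pd' := di_posdef HQ'.
pose S := [set i | pos (bw s (alpha i))].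
have [i0 i0S] : exists i, i \in S.
  apply: NNPP => no; have pw : pos (winv s b).
    by apply: contraR nb => nw; exact: inverted_in_beta_list.
  apply: (not_pos_opp qb pb); rewrite -[b](brefl_wordVK HQ s) (brefl_word_sum_alpha HQ).
  apply/posP => j; rewrite ffunE sum_ffunE oppr_ge0; apply: sumr_le0 => i _.
  rewrite ffunMzE -mulrzr intz; apply: mulr_le0_ge0; last exact: (posP _ pw).
  have ni : ~~ pos (bw s (alpha i)).
    by apply/negP => pi; apply: no; exists i; rewrite inE.
  have := root_sign pd (euler1_brefl_word HQ s (euler_alpha nl i)) ni.
  by move=> /posP /(_ j); rewrite ffunE oppr_ge0.
have closed a : src Q' a \in S -> tgt Q' a \in S.
  rewrite !inE; set i := src Q' a; set j := tgt Q' a => pi.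
  apply: contraT => nj; have qi := euler1_brefl_word HQ s (euler_alpha nl i).
  have qj := euler1_brefl_word HQ s (euler_alpha nl j).
  have pj := root_sign pd qj nj.
  have jin : - bw s (alpha j) \in beta_list s.
    apply: inverted_in_beta_list => //; first by rewrite eulerNl eulerNr opprK.
    rewrite (brefl_wordN HQ) (brefl_wordK HQ).
    exact/posN/pos_alpha/euler1_neq0/euler_alpha.
  have [] := euler_inverted adm ps qi pi _ jin; first by rewrite (brefl_wordK HQ) pos_alpha.
  rewrite eulerNr (euler_reflects _ _ HQ adm) oppr_le0 leNgt => /negP [].
  rewrite /euler sum_alpha_l alphaE eq_sym (negbTE (nl' a)) sub0r oppr_lt0.
  rewrite (bigD1 a) //= !alphaE !eqxx mulr1 ltr_wpDr //.
  by apply: sumr_ge0 => a' _; rewrite !alphaE mulr_ge0 //; case: eqP.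
apply: NNPP => no.
have arrow i : i \in S -> exists a, src Q' a == i.
  move=> iS; apply: NNPP => na; apply: no; exists i; last by move: iS; rewrite inE.
  by apply/forallP => a; apply/negP => e; apply: na; exists a.
(* Each vertex of [S] is the source of an arrow inside [S]. *)
pose E := [set a | (src Q' a \in S) && (tgt Q' a \in S)].
have le : (#|S| <= #|E|)%N.
  apply: leq_trans (leq_imset_card (src Q') E); apply: subset_leq_card.
  apply/subsetP => i iS; have [a /eqP e] := arrow i iS.
  apply/imsetP; exists a => //; rewrite inE e iS /=; apply: closed; by rewrite e.
pose x : root_lattice I := [ffun i => (i \in S)%:Z].
have x0 : x != 0 by apply/eqP => /ffunP /(_ i0); rewrite !ffunE i0S.
have := pd' x x0; rewrite ltNge => /negP [].
rewrite /euler subr_le0.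
have -> : \sum_i x i * x i = #|S|%:Z.
  rewrite -sum1_card [in RHS]big_mkcond (big_morph Posz PoszD (erefl _)).
  by apply: eq_bigr => i _; rewrite ffunE; case: (i \in S).
have -> : \sum_a x (src Q' a) * x (tgt Q' a) = #|E|%:Z.
  rewrite -sum1_card [in RHS]big_mkcond (big_morph Posz PoszD (erefl _)).
  apply: eq_bigr => a _; rewrite !ffunE [a \in E]inE.
  by case: (src Q' a \in S); case: (tgt Q' a \in S).
by rewrite lez_nat.
Qed.

End AdmissibleSequence.

(** * The complete admissible word and its length *)

Section LongestSequence.
Variables (I A : finType) (tau : I -> I) (tauA : A -> A) (Q : quiver I A).
Variable J : {set I}.
Implicit Types (x y z b c : root_lattice I) (s t : seq I).
Hypothesis HQ : definite_iquiver Q tau tauA.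
Hypothesis HJ : orbit_representatives tau J.
Let nl := di_loopless HQ.
Let pd := di_posdef HQ.
Local Notation T := (tau_act tau).
Local Notation br := (brefl Q tau).
Local Notation bw := (brefl_word Q tau).
Local Notation winv s := (brefl_word Q tau (rev s)).
Local Notation q b := (euler Q b b).
Local Notation betas := (betas tau Q).
Local Notation beta_list := (beta_list tau Q).

(** The sign pattern that makes the homological conditions hold for [b] before [c]. *)
Definition euler_ordered : rel (root_lattice I) :=
  fun b c => (0 <= euler Q b c) && (euler Q c b <= 0).

Record good_word s : Prop := GoodWord {
  gw_sub : {subset s <= J};
  gw_adm : iadmissible tau Q s;
  gw_pos : all (@pos I) (betas s);
  gw_uniq : uniq (beta_list s);
  gw_ordered : pairwise euler_ordered (beta_list s) }.

Lemma good_nil : good_word [::].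
Proof. by split. Qed.

Lemma good_rcons s i : good_word s -> i \in J -> sink (reflects tau Q s) i ->
  pos (bw s (alpha i)) -> good_word (rcons s i).
Proof.
move=> [sJ adm ps us os] iJ si pi.
have HQ' : definite_iquiver (reflects tau Q s) tau tauA := definite_reflects s HQ.
have TE : T (bw s (alpha i)) = bw s (alpha (tau i)).
  by rewrite (tau_brefl_word HQ) (tau_act_alpha HQ).
have new j : ~~ (bw s (alpha j) \in beta_list s).
  apply/negP => /(beta_list_inverted HQ ps) /negP [].
  by rewrite (brefl_wordK HQ) pos_alpha.
have orbP b : b \in tau_orbit tau (bw s (alpha i)) ->
    exists2 j, b = bw s (alpha j) & pos b.
  rewrite /tau_orbit; case: ifP => _; rewrite !inE.
    by move/eqP ->; exists i.
  case/orP => /eqP ->; [exists i | exists (tau i)] => //.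
  by rewrite (tau_pos HQ).
split.
- by move=> j; rewrite mem_rcons inE => /orP [/eqP ->|/sJ].
- by rewrite iadmissible_rcons adm si.
- by rewrite betas_rcons all_rcons pi.
- rewrite beta_list_rcons cat_uniq us /=; apply/andP; split.
    by apply/hasPn => b /orbP [j -> _]; exact: new.
  rewrite /tau_orbit; case: eqP => [//|/eqP ne] /=.
  by rewrite inE eq_sym ne.
- rewrite beta_list_rcons pairwise_cat os /=; apply/andP; split.
    apply/allrelP => b c bs /orbP [j cE pc].
    have qc : q c = 1 by rewrite cE; exact: (euler1_brefl_word HQ s (euler_alpha nl j)).
    have pw : pos (winv s c) by rewrite cE (brefl_wordK HQ) pos_alpha.
    by have [le ge] := euler_inverted HQ adm ps qc pc pw bs; rewrite /euler_ordered ge le.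
  rewrite /tau_orbit; case: eqP => [//|ne] /=; rewrite !andbT /euler_ordered TE.
  rewrite !(euler_reflects _ _ HQ adm) (euler_sink_l _ si).
  rewrite (euler_sink_l _ (sink_tau HQ' si)) !alphaE.
  have ni : (tau i == i) = false by apply/eqP => e; apply: ne; rewrite TE e.
  by rewrite (eq_sym i) ni.
Qed.

(** The list of roots grows as long as it is incomplete, and its size is bounded by
    [roots_finite]. *)
Lemma good_word_exists : exists2 s, good_word s &
  forall b, is_root Q b -> pos b -> b \in beta_list s.
Proof.
suff H n s : good_word s -> (3 ^ #|I| - size (beta_list s) < n)%N ->
    exists2 s, good_word s & forall b, is_root Q b -> pos b -> b \in beta_list s.
  by apply: (H _ [::] good_nil); exact: ltnSn.
elim: n s => // n IH s gs lt.
have [full|] := classic (forall b, is_root Q b -> pos b -> b \in beta_list s).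
  by exists s.
move=> /not_all_ex_not [b nb].
have [rb [pb {}nb]] : is_root Q b /\ pos b /\ b \notin beta_list s.
  split; first by apply: NNPP => nr; apply: nb.
  split; first by apply: NNPP => np; apply: nb.
  by apply/negP => bs; apply: nb.
have [adm ps] := (gw_adm gs, gw_pos gs).
have [l sl pl] := next_sink_exists HQ adm ps (root_euler nl rb) pb nb.
have [i [iJ si pi]] : exists i,
    [/\ i \in J, sink (reflects tau Q s) i & pos (bw s (alpha i))].
  have /set0Pn [i] : J :&: [set l; tau l] != set0 by rewrite -card_gt0 HJ.
  rewrite !inE => /andP [iJ /orP [/eqP il|/eqP il]]; exists i; rewrite il in iJ *.
    by split.
  split=> //; first exact: sink_tau (definite_reflects s HQ) sl.
  by rewrite -(tau_act_alpha HQ) -(tau_brefl_word HQ) (tau_pos HQ).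
have gs' := good_rcons gs iJ si pi.
apply: (IH _ gs'); have := roots_finite pd (gw_uniq gs') (@beta_list_q _ _ _ _ _ HQ _).
move: lt; rewrite beta_list_rcons size_cat.
have : (0 < size (tau_orbit tau (bw s (alpha i))))%N by rewrite /tau_orbit; case: ifP.
lia.
Qed.

Local Notation line := (tau_line tau).

Lemma line_count (l1 l2 : seq (root_lattice I)) :
  pairwise (fun b c => ~~ line b c) l1 -> (forall b, b \in l1 -> has (line b) l2) ->
  (size l1 <= size l2)%N.
Proof.
move=> pw cov; pose f b := find (line b) l2.
have u : uniq (map f l1).
  rewrite uniq_pairwise pairwise_map.
  apply: (@sub_in_pairwise _ (mem l1) _ _ _ _ (allss l1) pw) => b c bl cl /=.
  apply: contra => /eqP fbc; apply: (tau_line_trans HQ) (_ : line b (nth 0 l2 (f b))) _.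
    by apply: nth_find; exact: cov.
  by rewrite fbc; apply: nth_find; exact: cov.
rewrite -(size_map f) -(size_iota 0 (size l2)); apply: uniq_leq_size => // j.
by case/mapP => b bl ->; rewrite mem_iota /= add0n -has_find cov.
Qed.

Lemma good_betas_lines s : good_word s -> pairwise (fun b c => ~~ line b c) (betas s).
Proof.
move=> gs; have := gw_uniq gs; have := gw_pos gs; have := @beta_list_q _ _ _ _ _ HQ s.
rewrite /beta_list; elim: (betas s) => //= a l IH qs /andP [pa pl].
rewrite cat_uniq => /and3P [_ dis ul]; apply/andP; split; last first.
  by apply: IH => // b bl; apply: qs; rewrite mem_cat bl orbT.
have orb b : b \in tau_orbit tau b /\ T b \in tau_orbit tau b.
  by rewrite /tau_orbit; case: eqP => [->|_]; rewrite !inE !eqxx ?orbT.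
have ain : a \in tau_orbit tau a by have [] := orb a.
have qa : q a = 1 by apply: qs; rewrite mem_cat ain.
apply/allP => c cl.
have pc := allP pl _ cl.
have inl b : b \in tau_orbit tau c -> b \in flatten (map (tau_orbit tau) l).
  by move=> bc; apply/flattenP; exists (tau_orbit tau c) => //; exact: map_f.
have [cin tin] := orb c.
apply/negP => /or4P [] /eqP e.
- by move/hasPn: dis => /(_ _ (inl _ cin)); rewrite -e ain.
- by apply: (not_pos_opp qa pa); rewrite e opprK.
- by move/hasPn: dis => /(_ _ (inl _ tin)); rewrite -e ain.
- by apply: (not_pos_opp qa pa); rewrite e opprK (tau_pos HQ).
Qed.

(** A word for the same element inverts the same roots, hence lists all the
    [tau]-orbits of roots that [s] lists. *)
Lemma good_reduced s t : good_word s -> bw s =1 bw t -> (size s <= size t)%N.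
Proof.
move=> gs st; rewrite -(size_betas tau Q s) -(size_betas tau Q t).
apply: line_count; first exact: good_betas_lines.
move=> b bs; have bl : b \in beta_list s by exact: betas_sub.
have := beta_list_inverted HQ (gw_pos gs) bl.
have -> : winv s b = winv t b.
  by rewrite -[in RHS](brefl_wordVK HQ s b) st (brefl_wordK HQ).
move=> /(inverted_in_beta_list HQ (beta_list_q HQ bl) (allP (gw_pos gs) _ bs)).
case/beta_listP => c ct bc; apply/hasP; exists c => //.
by case: bc => ->; rewrite /tau_line eqxx ?orbT.
Qed.

Definition reduced t := forall t', {subset t' <= J} -> bw t =1 bw t' ->
  (size t <= size t')%N.

(** If the root listed first and the one listed at a later letter [k] were in the
    same class, the word could be rewritten so that the first letter is repeated,
    and both occurrences could be deleted. *)
Lemma reduced_lines t : {subset t <= J} -> reduced t ->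
  pairwise (fun b c => ~~ line b c) (betas t).
Proof.
elim: t => // j t IH sJ red.
have tJ : {subset t <= J} by move=> i it; apply: sJ; rewrite inE it orbT.
have jJ : j \in J by apply: sJ; rewrite inE eqxx.
have redt : reduced t.
  move=> t' t'J tt'; have := red (j :: t'); rewrite /= ltnS; apply.
    by move=> i; rewrite inE => /orP [/eqP ->|/t'J].
  by move=> x /=; rewrite -!/(brefl_word _ _ _ _) tt'.
have -> : betas (j :: t) = alpha j :: map (br j) (betas t) by [].
rewrite pairwise_cons; apply/andP; split; last first.
  rewrite pairwise_map; apply: sub_pairwise (IH tJ redt) => b c.
  by rewrite /= (tau_line_brefl HQ).
apply/allP => _ /mapP [c ct ->]; apply/negP => ln.
have [u [k [v [tE cE]]]] := betas_split ct.
have ln' : line (bw u (alpha k)) (alpha j).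
  apply: (tau_line_sym HQ); rewrite -(tau_line_brefl HQ j) -cE (brefl_alpha HQ).
  case/or4P: ln => /eqP e; rewrite /tau_line e ?(tau_actN, opprK) ?eqxx ?orbT //.
have conj := brefl_word_conj HQ ln'.
have := red (u ++ v); rewrite tE /= size_cat /= size_cat => H.
suff : (size u + (size v).+1 < size u + size v)%N by lia.
apply: H.
  move=> i; rewrite mem_cat => iuv; apply: tJ; rewrite tE mem_cat inE.
  by case/orP: iuv => ->; rewrite ?orbT.
move=> x /=; rewrite -!/(brefl_word _ _ _ _) !brefl_word_cat /=.
by rewrite -!/(brefl_word _ _ _ _) conj (breflK HQ).
Qed.

(** By [reduced_lines] the letters of [t] correspond to distinct classes of
    roots, and each class meets the list of [s]. *)
Lemma reduced_le s t : (forall b, is_root Q b -> pos b -> b \in beta_list s) ->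
  {subset t <= J} -> reduced t -> (size t <= size s)%N.
Proof.
move=> full tJ red; rewrite -(size_betas tau Q s) -(size_betas tau Q t).
apply: line_count; first exact: reduced_lines.
move=> b bt; have rb := beta_list_root HQ (betas_sub bt).
have qb := root_euler nl rb.
have [pb|nb] := boolP (pos b).
  have /beta_listP [c cs bc] := full _ rb pb.
  by apply/hasP; exists c => //; case: bc => ->; rewrite /tau_line eqxx ?orbT.
have rb' : is_root Q (- b).
  have [u [i [v [_ bE]]]] := betas_split bt.
  have -> : - b = bw (rcons u i) (alpha i).
    by rewrite brefl_word_rcons (brefl_alpha HQ) (brefl_wordN HQ) bE.
  by apply: brefl_word_root; exists [::], i.
have /beta_listP [c cs bc] := full _ rb' (root_sign pd qb nb).
apply/hasP; exists c => //; rewrite -[b]opprK.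
by case: bc => ->; rewrite /tau_line eqxx ?orbT.
Qed.

End LongestSequence.

(** An arrow between [i] and [tau i] would have a parallel one, its image under the
    automorphism, while a Dynkin diagram has simple edges. *)
Lemma dynkin_definite (I A : finType) (Q : quiver I A) (tau : I -> I)
    (tauA : A -> A) :
  dynkin_iquiver Q tau tauA -> definite_iquiver Q tau tauA.
Proof.
case=> dQ hs ht tauK tauAK.
have nl := dynkin_loopless dQ.
split=> //; first exact: dynkin_posdef.
move=> i ne; rewrite cform_alpha // /cartan eq_sym (negbTE ne).
suff -> : nedges Q i (tau i) = 0%N by [].
apply/eqP; rewrite cards_eq0; apply/set0Pn => -[a]; rewrite inE => ha.
have := dynkin_nedges_le1 i (tau i) dQ; rewrite leqNgt => /negP []; apply/card_gt1P.
exists a, (tauA a); split; rewrite ?inE ?hs ?ht //.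
  rewrite !(can2_eq tauK tauK) tauK.
  by case/orP: ha => /andP [-> ->]; rewrite ?orbT.
apply/eqP => e; have := hs a; have := ht a; rewrite -e => e1 e2.
by move/eqP: ne; apply; case/orP: ha => /andP [/eqP h1 /eqP h2];
  [rewrite -h1 -e2 | rewrite -h2 -e1].
Qed.

Theorem theoremD (I A : finType) (Q : quiver I A)
    (tau : I -> I) (tauA : A -> A) (J : {set I})
    (w0 : root_lattice I -> root_lattice I) (N : nat)
    (HQ : dynkin_iquiver Q tau tauA)
    (HJ : orbit_representatives tau J)
    (Hw0 : Wtau_longest Q tau J w0)
    (HN : Wtau_length Q tau J w0 N) :
  exists s : N.-tuple I,
    [/\ {subset s <= J},
        iadmissible tau Q s
      & Q_admissible Q (beta_seq Q tau s)].
Proof.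
have dQ := dynkin_definite HQ.
have nl := di_loopless dQ; have pd := di_posdef dQ.
have [s gs full] := good_word_exists dQ HJ.
have sN : size s = N.
  apply/eqP; rewrite eqn_leq; apply/andP; split.
    have [_ longest] := Hw0.
    apply: (longest _ _ _ (brefl_word_in_Wtau dQ s) _ HN); split.
      by exists s; split=> //; exact: gw_sub gs.
    by move=> t _ st; exact: (good_reduced dQ gs st).
  have [[t [tJ w0t tN]] least] := HN; rewrite -tN.
  apply: (reduced_le dQ full tJ) => t' t'J tt'.
  rewrite tN; apply: least => // x.
  by rewrite w0t tt'.
pose r : N.-tuple I := Tuple (introT eqP sN).
exists r; split; [exact: gw_sub gs | exact: gw_adm gs |].
have -> : beta_seq Q tau r = beta_list tau Q s by rewrite beta_seqE.
split; first exact: gw_uniq gs.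
  move=> b; split=> [bs|[rb /posP pb]]; last exact: full.
  split; first exact: (beta_list_root dQ bs).
  by apply/posP; exact: (pos_beta_list dQ (gw_pos gs) bs).
move=> k i j M N' ilt jlt [indM dM] [indN dN].
set L := beta_list tau Q s in ilt jlt dM dN *.
have ME : dimvec M = nth 0 L i by apply/ffunP => p; rewrite ffunE dM.
have NE : dimvec N' = nth 0 L j by apply/ffunP => p; rewrite ffunE dN.
have eulerE := euler_hom_ext M N'; rewrite ME NE in eulerE.
have ord := pairwiseP 0 (gw_ordered gs).
(* One of the two spaces vanishes, so the sign of the Euler form controls the other. *)
have dir : hom_dim M N' = 0%N \/ ext_dim M N' = 0%N.
  have [h0|nh] := classic (hom_dim M N' = 0%N); [by left | right].
  apply/ext_eq0; apply: NNPP => ne; apply: nh; apply/hom_eq0 => f hf i0.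
  apply: NNPP => nf; apply: ne; apply: (hom_ext0 pd indM indN hf) => f0.
  exact/nf/f0.
split.
  case=> f [hf [i0 nf]]; rewrite leqNgt; apply/negP => ji.
  have nh : hom_dim M N' <> 0%N by move/hom_eq0 => /(_ f hf i0).
  have /andP [_] := ord _ _ jlt ilt ji.
  by case: dir => // e0; rewrite eulerE e0; lia.
move=> /ext1_nonzeroP ne; rewrite ltnNge; apply/negP => ij.
have nx : ext_dim M N' <> 0%N by move/ext_eq0.
have : 0 <= euler Q (nth 0 L i) (nth 0 L j).
  move: ij; rewrite leq_eqVlt => /orP [/eqP e|lt].
    by rewrite e (beta_list_q dQ (mem_nth 0 jlt)).
  by have /andP [] := ord _ _ ilt jlt lt.
by case: dir => // h0; rewrite eulerE h0; lia.
Qed.
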